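(* Fix $I\in\mathbb{N}$. (a) Let $\psi^0\in\mathcal{D}^1:=\mathcal{D}\cap \mathcal{C}^1(\mathbb{R}_+,\mathbb{R}_+)^I$ and define $\psi_i(u,t):=(\Upsilon^{-1}\circ\theta_t\circ\Upsilon\circ\psi^0)_i(u)$. Then $\psi_i\in C^1(\mathbb{R}_+^2,\mathbb{R}_+)$ for each $i$, $\psi(\cdot,t)\in\mathcal{D}^1$ for all $t\ge0$, and \[\partial_t\psi_i=-v_i^{\mathrm{eff}}\left(\partial_u\psi\right)\partial_u\psi_i,\quad i=1,\dots,I,\qquad \psi(\cdot,0)=\psi^0.\] Moreover, $\psi$ is the unique solution of this problem in the class of $\psi \in C^1(\mathbb{R}_+^2,\mathbb{R}_+)^I$ with $\psi(\cdot,t) \in \mathcal{D}^1$ for all $t \ge0$. (b) Let $\rho^0\in \mathcal{D}_{\mathrm{density}}$, set $\psi^0_i(u):=\int_0^u\rho^0_i(u')du'$ and define $\psi_i(u,t)$ as in (a). Then $\psi_i\in C^2(\mathbb{R}_+^2,\mathbb{R}_+)$ for each $i$, $\rho_i(u,t):=\partial_u\psi_i(u,t)$ satisfies $\rho_i\in C^1(\mathbb{R}_+^2,\mathbb{R}_+)$, $\rho(\cdot,t)\in\mathcal{D}_{\mathrm{density}}$ for all $t\ge0$, and \[\partial_t \rho_i =- \partial_u \left( v_i^{\mathrm{eff}}(\rho) \rho_i\right),\quad \rho_i(\cdot,0)=\rho^0_i,\qquad i=1,\dots,I.\] Moreover, $\rho$ is the unique solution of this problem in the class of $\rho \in C^1(\mathbb{R}_+^2,\mathbb{R}_+)^{I}$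 with $\rho(\cdot,t) \in \mathcal{D}_{\mathrm{density}}$ for all $t \ge0$.
   Context: $\mathcal{C}=\{f\in C(\mathbb{R}_+,\mathbb{R}_+):f(0)=0,f\text{ non-decreasing}\}$, $\mathcal{C}^\uparrow=\{f\in\mathcal{C}:f\text{ strictly increasing},\lim_{u\to\infty}f(u)=\infty\}$. For $\psi\in\mathcal{C}^I$, $\phi_i(u)=u-\sum_{j=1}^I2(i\wedge j)\psi_j(u)$. $\mathcal{D}=\{\psi\in\mathcal{C}^I:\phi_I\in\mathcal{C}^\uparrow,\sum_{i=1}^Ii\sup_{u_1\neq u_2}\frac{\psi_i(u_1)-\psi_i(u_2)}{\phi_i(u_1)-\phi_i(u_2)}<\frac12\}$ (each $\phi_i$ is then in $\mathcal{C}^\uparrow$). $\Upsilon(\psi)_i:=\psi_i\circ\phi_i^{-1}$; $\Upsilon$ is a bijection from $\mathcal{D}$ onto $\bar{\mathcal{D}}=\{\bar\psi\in\mathcal{C}^I:\sum_ii\sup_{z_1\neq z_2}\frac{\bar\psi_i(z_1)-\bar\psi_i(z_2)}{z_1-z_2}<\frac12\}$, with inverse $\Upsilon^{-1}$. $(\theta_t\bar\psi)_i(z):=\bar\psi_i((z-it)\vee0)$, which maps $\bar{\mathcal{D}}$ into itself. $\mathcal{C}^1(\mathbb{R}_+,\mathbb{R}_+)$: functions $f:\mathbb{R}_+\to\mathbb{R}_+$ whose extension by $0$ on $(-\infty,0)$ is $C^1$ on $\mathbb{R}$. Effective speeds: for $\rho\in\mathbb{R}_+^I$ with $\sum_i 2i\rho_i<1$,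 $M(\rho)$ has $M_{ii}=1-\sum_{j\ne i}2(i\wedge j)\rho_j$, $M_{ij}=2(i\wedge j)\rho_j$ ($i\neq j$), and $v^{\mathrm{eff}}(\rho)=M(\rho)^{-1}(1,2,\dots,I)^T$ (evaluated pointwise in $(u,t)$). $\mathcal{D}_{\mathrm{density}}$: $\rho\in\mathcal{C}^1(\mathbb{R}_+,\mathbb{R}_+)^I$ with $\sum_i2i\rho_i(u)<1$ for all $u$ and $\sum_ii\sup_u\frac{\rho_i(u)}{1-\sum_j2(i\wedge j)\rho_j(u)}<\frac12$. *)

(* Defs.v *)
From Stdlib Require Import Reals ClassicalEpsilon.
From Coquelicot Require Import Coquelicot.
From mathcomp Require Import all_boot all_algebra.
From mathcomp Require Import Rstruct.

Set Implicit Arguments.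
Unset Strict Implicit.
Unset Printing Implicit Defensive.

(* Indices i = 1..I are represented by  i : 'I_I  with mathematical value i.+1.
   A vector of functions psi = (psi_1,...,psi_I) is  'I_I -> R -> R ;
   only the values on R_+ = [0, +oo) matter. *)

Local Open Scope ring_scope.

Definition phi (I : nat) (psi : 'I_I -> R -> R) (i : 'I_I) (u : R) : R :=
  u - \sum_(j < I) (2 * (minn i.+1 j.+1)%:R * psi j u).

Definition wsum (I : nat) (L : 'I_I -> R) : R := \sum_(i < I) ((i.+1)%:R * L i).

Definition wsum2 (I : nat) (r : 'I_I -> R) : R := \sum_(i < I) (2 * (i.+1)%:R * r i).

Definition dens_denom (I : nat) (r : 'I_I -> R) (i : 'I_I) : R :=
  1 - \sum_(j < I) (2 * (minn i.+1 j.+1)%:R * r j).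

Definition Mmat (I : nat) (r : 'I_I -> R) : 'M[R]_I :=
  \matrix_(i < I, j < I)
    (if i == j then 1 - \sum_(k < I | k != i) (2 * (minn i.+1 k.+1)%:R * r k)
     else 2 * (minn i.+1 j.+1)%:R * r j).

Definition veff (I : nat) (r : 'I_I -> R) (i : 'I_I) : R :=
  (invmx (Mmat r) *m (\col_(k < I) (k.+1)%:R)) i ord0.

Local Close Scope ring_scope.

Local Open Scope R_scope.

Definition cont_pos (f : R -> R) : Prop :=
  forall u, 0 <= u -> forall eps, 0 < eps -> exists delta, 0 < delta /\
    forall v, 0 <= v -> Rabs (v - u) < delta -> Rabs (f v - f u) < eps.

Definition inC (f : R -> R) : Prop :=
  f 0 = 0 /\ (forall u, 0 <= u -> 0 <= f u) /\ cont_pos f /\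
  (forall u v, 0 <= u -> u <= v -> f u <= f v).

Definition inCup (f : R -> R) : Prop :=
  inC f /\ (forall u v, 0 <= u -> u < v -> f u < f v) /\
  (forall M, exists U, 0 <= U /\ forall u, U <= u -> M <= f u).

(* psi in D.  The condition  sum_i i sup_{u1<>u2} q_i(u1,u2) < 1/2  is written as:
   there are bounds L_i of the quotients q_i with sum_i i L_i < 1/2. *)
Definition InD (I : nat) (psi : 'I_I -> R -> R) : Prop :=
  (forall i, inC (psi i)) /\
  (forall i : 'I_I, i.+1 = I -> inCup (phi psi i)) /\
  (exists L : 'I_I -> R, wsum L < 1/2 /\
     forall i u1 u2, 0 <= u1 -> 0 <= u2 -> u1 <> u2 ->
       (psi i u1 - psi i u2) / (phi psi i u1 - phi psi i u2) <= L i).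

Definition ext0 (f : R -> R) (u : R) : R := if Rlt_dec u 0 then 0 else f u.

Definition C1_pos (f : R -> R) : Prop :=
  (forall u, 0 <= u -> 0 <= f u) /\
  exists f' : R -> R, (forall x, derivable_pt_lim (ext0 f) x (f' x)) /\ continuity f'.

Definition InD1 (I : nat) (psi : 'I_I -> R -> R) : Prop :=
  InD psi /\ forall i, C1_pos (psi i).

Definition InDdens (I : nat) (rho : 'I_I -> R -> R) : Prop :=
  (forall i, C1_pos (rho i)) /\
  (forall u, 0 <= u -> wsum2 (fun j => rho j u) < 1) /\
  (exists L : 'I_I -> R, wsum L < 1/2 /\
     forall i u, 0 <= u -> rho i u / dens_denom (fun j => rho j u) i <= L i).

Definition inv_pos (f : R -> R) (z : R) : R :=
  epsilon (inhabits 0) (fun u => 0 <= u /\ f u = z).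

Definition Upsilon (I : nat) (psi : 'I_I -> R -> R) : 'I_I -> R -> R :=
  fun i z => psi i (inv_pos (phi psi i) z).

Definition Upsilon_inv (I : nat) (pb : 'I_I -> R -> R) : 'I_I -> R -> R :=
  epsilon (inhabits (fun (_ : 'I_I) (_ : R) => 0))
    (fun psi => InD psi /\ forall i z, 0 <= z -> Upsilon psi i z = pb i z).

Definition theta (I : nat) (t : R) (pb : 'I_I -> R -> R) : 'I_I -> R -> R :=
  fun i z => pb i (Rmax (z - INR i.+1 * t) 0).

Definition psi_sol (I : nat) (psi0 : 'I_I -> R -> R) : 'I_I -> R -> R -> R :=
  fun i u t => Upsilon_inv (theta t (Upsilon psi0)) i u.

Definition cont_Q (g : R -> R -> R) : Prop :=
  forall u t, 0 <= u -> 0 <= t -> forall eps, 0 < eps -> exists delta, 0 < delta /\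
    forall u' t', 0 <= u' -> 0 <= t' -> Rabs (u' - u) < delta -> Rabs (t' - t) < delta ->
      Rabs (g u' t' - g u t) < eps.

Definition derivs_Q (f Du Dt : R -> R -> R) : Prop :=
  forall u t, 0 <= u -> 0 <= t -> forall eps, 0 < eps -> exists delta, 0 < delta /\
    forall h k, 0 <= u + h -> 0 <= t + k -> Rabs h < delta -> Rabs k < delta ->
      Rabs (f (u + h) (t + k) - f u t - Du u t * h - Dt u t * k)
        <= eps * (Rabs h + Rabs k).

Definition C1_Q (f Du Dt : R -> R -> R) : Prop :=
  derivs_Q f Du Dt /\ cont_Q Du /\ cont_Q Dt.

Definition C2_Q (f Du Dt : R -> R -> R) : Prop :=
  C1_Q f Du Dt /\
  (exists Duu Dut, C1_Q Du Duu Dut) /\ (exists Dtu Dtt, C1_Q Dt Dtu Dtt).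

Definition nonneg_Q (f : R -> R -> R) : Prop :=
  forall u t, 0 <= u -> 0 <= t -> 0 <= f u t.

Definition pderiv_u (f : R -> R -> R) (u t l : R) : Prop :=
  forall eps, 0 < eps -> exists delta, 0 < delta /\
    forall h, 0 <= u + h -> Rabs h < delta ->
      Rabs (f (u + h) t - f u t - l * h) <= eps * Rabs h.

Definition solves_a (I : nat) (psi0 : 'I_I -> R -> R) (Psi : 'I_I -> R -> R -> R) : Prop :=
  (forall i, nonneg_Q (Psi i)) /\
  (forall t, 0 <= t -> InD1 (fun i u => Psi i u t)) /\
  (forall i u, 0 <= u -> Psi i u 0 = psi0 i u) /\
  exists Du Dt : 'I_I -> R -> R -> R,
    (forall i, C1_Q (Psi i) (Du i) (Dt i)) /\
    (forall i u t, 0 <= u -> 0 <= t ->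
       Dt i u t = - (veff (fun j => Du j u t) i * Du i u t)).

Definition solves_b (I : nat) (rho0 : 'I_I -> R -> R) (rho : 'I_I -> R -> R -> R) : Prop :=
  (forall i, nonneg_Q (rho i)) /\
  (forall t, 0 <= t -> InDdens (fun i u => rho i u t)) /\
  (forall i u, 0 <= u -> rho i u 0 = rho0 i u) /\
  exists (Ru Rt : 'I_I -> R -> R -> R) (G : 'I_I -> R -> R -> R),
    (forall i, C1_Q (rho i) (Ru i) (Rt i)) /\
    (forall i u t, 0 <= u -> 0 <= t ->
       pderiv_u (fun u' t' => veff (fun j => rho j u' t') i * rho i u' t') u t (G i u t) /\
       Rt i u t = - G i u t).

Local Close Scope R_scope.

(* Main.v *)
(* Put K_ij = 2 (i /\ j).  Composing with phi_i^-1 turns an element of D into functions F_i with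
   slopes in [0, L_i], kappa = sum_j 2 j L_j < 1, and recovers phi as the solution of
   z_i = u - sum_j K_ij F_j(z_j), a contraction because K_ij <= 2 j.  After extending F by 0 to the
   negative reals, the candidate solution is psi_i = F_i(Y_i), where Y solves
   Y_i = u - i t - sum_j K_ij F_j(Y_j) on the whole plane.  Differentiating this system gives
   dY_i = w_i du - x_i dt, where w and x solve contractive linear systems with coefficients
   a_j = F_j'(Y_j); the equation defining the effective speeds becomes x_i = w_i v_i, which is
   the transport equation.  One further differentiation gives the C^2 statement.
   Conversely, for any solution Psi, each Psi_i is constant along the level curves
   phi_i(u, t) - i t = s, which start either on t = 0 or on u = 0; hence Psi_i = F_i(phi_i - i t), and
   uniqueness follows from uniqueness of the fixed point.  Part (b) is reduced to (a) by
   integrating the density in u. *)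
Require Import Defs.
From Stdlib Require Import Reals Lra ClassicalEpsilon.
From Coquelicot Require Import Coquelicot.
From mathcomp Require Import all_boot all_algebra.
From mathcomp Require Import Rstruct.

Set Implicit Arguments.
Unset Strict Implicit.
Unset Printing Implicit Defensive.
Local Open Scope R_scope.

(** * Weighted sums and the contractive system *)

(** The obstacle on the quadrant is its boundary: only one-sided derivatives exist there, and
    functions chosen by [epsilon] are controlled on non-negative arguments only. Extending by zero
    moves the work to the whole plane: theta_t becomes a plain translation, the C^1 condition on the
    zero extension of psi makes F differentiable on R, and Y is differentiated two-sidedly before
    restriction to the quadrant. Two estimates carry everything. The norm estimate needs only kappa
    < 1 and gives existence, uniqueness and continuity. The sign estimate also uses that the slopes
    are non-negative; it gives phi_i a slope of at least 1 - kappa, for kappa arbitrarily close to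
    1. Differentiability of Y comes from freezing the coefficients at one point, which leaves a
    constant linear system with an explicit resolvent. The invertibility of M(rho) follows from
    uniqueness in the same kind of system. A competing solution has its own bounds L at each time,
    with no uniformity in t. Its comparison with the candidate therefore goes through level curves
    and monotonicity, and only the F of the initial datum enters the last fixed-point argument. *)

Definition rsum (I : nat) (f : 'I_I -> R) : R := (\sum_(i < I) f i)%R.

Section Sums.
Context (I : nat).
Implicit Types f g : 'I_I -> R.

Lemma rsum_ext f g : (forall i, f i = g i) -> rsum f = rsum g.
Proof. by move=> fg; apply: eq_bigr. Qed.

Lemma rsum_plus f g : rsum (fun i => f i + g i) = rsum f + rsum g.
Proof. exact: big_split. Qed.

Lemma rsum_scal c f : rsum (fun i => c * f i) = c * rsum f.
Proof. by rewrite /rsum RmultE GRing.mulr_sumr. Qed.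

Lemma rsum_opp f : rsum (fun i => - f i) = - rsum f.
Proof. by rewrite -(Rmult_1_l (rsum f)) Ropp_mult_distr_l -rsum_scal; apply: rsum_ext => i; ring. Qed.

Lemma rsum_minus f g : rsum (fun i => f i - g i) = rsum f - rsum g.
Proof. by rewrite rsum_plus rsum_opp. Qed.

Lemma rsum0 f : (forall i, f i = 0) -> rsum f = 0.
Proof. by move=> f0; apply: big1 => i _; apply: f0. Qed.

Lemma rsum_ind (P : R -> Prop) f :
  P 0 -> (forall x y, P x -> P y -> P (x + y)) -> (forall i, P (f i)) -> P (rsum f).
Proof. by move=> P0 PD Pf; apply: (big_ind P) => //. Qed.

Lemma rsum_ge0 f : (forall i, 0 <= f i) -> 0 <= rsum f.
Proof. by move=> f0; apply: (rsum_ind (P := Rle 0)) => [|x y x0 y0|//]; [exact: Rle_refl|lra]. Qed.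

Lemma rsum_le f g : (forall i, f i <= g i) -> rsum f <= rsum g.
Proof.
move=> fg; suff: 0 <= rsum (fun i => g i - f i) by rewrite rsum_minus; lra.
by apply: rsum_ge0 => i; have := fg i; lra.
Qed.

Lemma rsum_Rabs f : Rabs (rsum f) <= rsum (fun i => Rabs (f i)).
Proof.
apply: Rabs_le; split; last by apply: rsum_le => i; apply: Rle_abs.
by rewrite -rsum_opp; apply: rsum_le => i; have := Rle_abs (- f i); rewrite Rabs_Ropp; lra.
Qed.

Lemma rsum_term_le f i : (forall j, 0 <= f j) -> f i <= rsum f.
Proof.
move=> f0; rewrite /rsum (bigD1 i) //= -RplusE.
rewrite -{1}(Rplus_0_r (f i)); apply: Rplus_le_compat_l.
by apply: (big_ind (fun x => 0 <= x)) => [|x y x0 y0|//]; [exact: Rle_refl|by rewrite -RplusE; lra].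
Qed.

Lemma rsum_lim (x : R) (f : 'I_I -> R -> R) (l : 'I_I -> R) :
  (forall i, derivable_pt_lim (f i) x (l i)) ->
  derivable_pt_lim (fun y => rsum (fun i => f i y)) x (rsum l).
Proof.
move=> fl; apply/is_derive_Reals; rewrite /rsum.
elim: (index_enum _) => [|i s IHs].
  by rewrite big_nil; apply: (is_derive_ext (fun _ => 0)) => [t|]; [rewrite big_nil|apply: is_derive_const].
rewrite big_cons; apply: (is_derive_ext (fun y => f i y + (\sum_(j <- s) f j y)%R)).
  by move=> t; rewrite big_cons.
by apply: is_derive_plus => //; apply/is_derive_Reals.
Qed.

Lemma rsum_lim_seq (f : 'I_I -> nat -> R) (l : 'I_I -> R) :
  (forall i, is_lim_seq (f i) (l i)) -> is_lim_seq (fun n => rsum (fun i => f i n)) (rsum l).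
Proof.
move=> fl; rewrite /rsum; elim: (index_enum _) => [|i s IHs].
  by apply: (is_lim_seq_ext (fun _ => 0)) => [n|]; rewrite big_nil //; apply: is_lim_seq_const.
rewrite big_cons; apply: (is_lim_seq_ext (fun n => f i n + (\sum_(j <- s) f j n)%R)).
  by move=> n; rewrite big_cons.
exact: is_lim_seq_plus'.
Qed.

Lemma rsum_continuity_2d (f : 'I_I -> R -> R -> R) x y :
  (forall i, continuity_2d_pt (f i) x y) ->
  continuity_2d_pt (fun u v => rsum (fun i => f i u v)) x y.
Proof.
move=> cf; rewrite /rsum; elim: (index_enum _) => [|i s IHs].
  apply: (continuity_2d_pt_ext (fun _ _ => 0)) => [u v|]; first by rewrite big_nil.
  exact: continuity_2d_pt_const.
apply: (continuity_2d_pt_ext (fun u v => f i u v + (\sum_(j <- s) f j u v)%R)).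
  by move=> u v; rewrite big_cons.
exact: continuity_2d_pt_plus.
Qed.

End Sums.

Definition K (I : nat) (i j : 'I_I) : R := 2 * INR (minn i.+1 j.+1).

(** The weights 2 j dominate every row of [K], so one scalar bounds all kernel sums at once;
    [ksum L] is the contraction constant kappa. *)
Definition ksum (I : nat) (L : 'I_I -> R) : R := rsum (fun j => 2 * INR j.+1 * L j).

Section Kernel.
Context (I : nat).
Implicit Types (i j : 'I_I) (L e r g : 'I_I -> R).

Lemma two_natrE (n : nat) : (2 * n%:R)%R = 2 * INR n.
Proof. by rewrite INRE RmultE; congr (_ * _)%R; rewrite -INRE /=; lra. Qed.

Lemma phiE (psi : 'I_I -> R -> R) i u :
  phi psi i u = u - rsum (fun j => K i j * psi j u).
Proof.
rewrite -[LHS]/(u - rsum (fun j => 2 * (minn i.+1 j.+1)%:R * psi j u)%R).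
by congr (_ - _); apply: rsum_ext => j; rewrite two_natrE.
Qed.

Lemma dens_denomE r i : dens_denom r i = 1 - rsum (fun j => K i j * r j).
Proof.
rewrite -[LHS]/(1 - rsum (fun j => 2 * (minn i.+1 j.+1)%:R * r j)%R).
by congr (_ - _); apply: rsum_ext => j; rewrite two_natrE.
Qed.

Lemma wsum_ksum L : ksum L = 2 * wsum L.
Proof.
rewrite -[wsum L]/(rsum (fun j => (j.+1%:R * L j)%R)) /ksum -rsum_scal.
apply: rsum_ext => i; rewrite -[(_ * _)%R]/((i.+1)%:R%R * L i) -INRE; ring.
Qed.

Lemma wsum2E r : wsum2 r = ksum r.
Proof. by apply: rsum_ext => j; rewrite two_natrE. Qed.

Lemma K_ge0 i j : 0 <= K i j.
Proof. by rewrite /K; have := pos_INR (minn i.+1 j.+1); lra. Qed.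

Lemma K_le i j : K i j <= 2 * INR j.+1.
Proof. by rewrite /K; have /leP/le_INR := geq_minr i.+1 j.+1; lra. Qed.

Lemma Ksum_minus i e r :
  rsum (fun j => K i j * (e j - r j)) = rsum (fun j => K i j * e j) - rsum (fun j => K i j * r j).
Proof. by rewrite -rsum_minus; apply: rsum_ext => j; ring. Qed.

Lemma ksum_ext e r : (forall j, e j = r j) -> ksum e = ksum r.
Proof. by move=> er; apply: rsum_ext => j; rewrite er. Qed.

Lemma Kwt_ge0 j : 0 <= 2 * INR j.+1.
Proof. by have := pos_INR j.+1; lra. Qed.

Lemma ksum_le e r : (forall j, e j <= r j) -> ksum e <= ksum r.
Proof. by move=> er; apply: rsum_le => j; apply: Rmult_le_compat_l => //; apply: Kwt_ge0. Qed.

Lemma ksum_ge0 e : (forall j, 0 <= e j) -> 0 <= ksum e.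
Proof. by move=> e0; apply: rsum_ge0 => j; apply: Rmult_le_pos => //; apply: Kwt_ge0. Qed.

Lemma ksum_scal c e : ksum (fun j => c * e j) = c * ksum e.
Proof. by rewrite /ksum -rsum_scal; apply: rsum_ext => j; ring. Qed.

Lemma Ksum_le i e : (forall j, 0 <= e j) -> rsum (fun j => K i j * e j) <= ksum e.
Proof. by move=> e0; apply: rsum_le => j; apply: Rmult_le_compat_r => //; apply: K_le. Qed.

Lemma Ksum_abs_le i e r : (forall j, Rabs (e j) <= r j) ->
  Rabs (rsum (fun j => K i j * e j)) <= ksum r.
Proof.
move=> er; apply: Rle_trans (rsum_Rabs _) _.
apply: Rle_trans (ksum_le er); apply: Rle_trans (Ksum_le i (fun j => Rabs_pos (e j))).
by apply: rsum_le => j; rewrite Rabs_mult (Rabs_pos_eq (K i j)); [lra|apply: K_ge0].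
Qed.

(** The weighted sum N of the [L j * Rabs (e j)] closes on itself: each |e_j| is at most B + N,
    hence N <= kappa (B + N). Since [g] is free, the bound serves differences of nonlinear terms as
    well as linear terms with a perturbed right-hand side. *)
Lemma contraction L e r g (B : R) :
  (forall j, 0 <= L j) -> ksum L < 1 ->
  (forall i, e i = r i - rsum (fun j => K i j * g j)) ->
  (forall j, Rabs (g j) <= L j * Rabs (e j)) -> (forall i, Rabs (r i) <= B) ->
  forall i, Rabs (e i) <= B / (1 - ksum L).
Proof.
move=> L0 L1 eE gL rB i.
set N := ksum (fun j => L j * Rabs (e j)).
have eB j : Rabs (e j) <= B + N.
  rewrite eE; apply: Rle_trans (Rabs_triang _ _) _; rewrite Rabs_Ropp.
  by have := rB j; have := Ksum_abs_le j gL; rewrite -/N; lra.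
have NB : N <= ksum L * (B + N).
  rewrite Rmult_comm -ksum_scal; apply: ksum_le => j; rewrite Rmult_comm.
  exact: Rmult_le_compat_r.
apply/(Rmult_le_reg_r (1 - ksum L)); first lra.
rewrite /Rdiv Rmult_assoc Rinv_l; last lra.
have := Rmult_le_compat_r (1 - ksum L) _ _ _ (eB i).
by have := ksum_ge0 L0; nra.
Qed.

(** [contraction] would give |e_i| <= d / (1 - kappa) without a sign. Splitting e into its positive
    part p and negative part n, and using that [K] and [l] are non-negative, yields d - Np <= e_j <=
    d + Nn; the two weighted sums then bound each other until Nn = 0. *)
Lemma positivity L e l (d : R) :
  (forall j, 0 <= l j <= L j) -> ksum L < 1 -> 0 <= d ->
  (forall i, e i = d - rsum (fun j => K i j * (l j * e j))) ->
  forall i, (1 - ksum L) * d <= e i <= d.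
Proof.
move=> lL L1 d0 eE.
have l0 j : 0 <= l j by case: (lL j).
pose p j := Rmax (e j) 0; pose n j := Rmax (- e j) 0.
have [p0 n0] : (forall j, 0 <= p j) /\ (forall j, 0 <= n j).
  by split=> j; apply: Rmax_r.
have epn j : e j = p j - n j.
  by rewrite /p /n /Rmax; case: Rle_dec; case: Rle_dec; lra.
have lp0 j : 0 <= l j * p j by apply: Rmult_le_pos.
have ln0 j : 0 <= l j * n j by apply: Rmult_le_pos.
set k := ksum l; have k0 : 0 <= k by apply: ksum_ge0.
have kL : k <= ksum L by apply: ksum_le => j; case: (lL j).
set Np := ksum (fun j => l j * p j); set Nn := ksum (fun j => l j * n j).
have Np0 : 0 <= Np by apply: ksum_ge0.
have Nn0 : 0 <= Nn by apply: ksum_ge0.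
have bnd j : d - Np <= e j <= d + Nn.
  rewrite eE (@rsum_ext _ _ (fun m => K j m * (l m * p m - l m * n m))); last first.
    by move=> m; rewrite epn; ring.
  rewrite (Ksum_minus j (fun m => l m * p m) (fun m => l m * n m)); have := Ksum_le j lp0; have := Ksum_le j ln0; rewrite -/Np -/Nn.
  have A : 0 <= rsum (fun m => K j m * (l m * p m)).
    by apply: rsum_ge0 => m; apply: Rmult_le_pos => //; apply: K_ge0.
  have A' : 0 <= rsum (fun m => K j m * (l m * n m)).
    by apply: rsum_ge0 => m; apply: Rmult_le_pos => //; apply: K_ge0.
  by lra.
have NpB : Np <= k * (d + Nn).
  rewrite Rmult_comm -ksum_scal; apply: ksum_le => j; rewrite Rmult_comm.
  by apply: Rmult_le_compat_r => //; have := bnd j; rewrite /p /Rmax; case: Rle_dec; lra.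
(* If d <= Np, the bounds Nn <= k (Np - d) and Np <= k (d + Nn) with k < 1 force Nn = 0. Otherwise
   every e_j is at least d - Np > 0, so n vanishes. *)
have [dNp|dNp] := Rle_dec d Np.
  have NnB : Nn <= k * (Np - d).
    rewrite Rmult_comm -ksum_scal; apply: ksum_le => j; rewrite Rmult_comm.
    by apply: Rmult_le_compat_r => //; have := bnd j; rewrite /n /Rmax; case: Rle_dec; lra.
  have : Nn = 0 by nra.
  by move=> Nz i; have := bnd i; nra.
have NnZ : Nn = 0.
  rewrite /Nn (@ksum_ext _ (fun j => 0 * l j)) ?ksum_scal; first ring.
  by move=> j; have := bnd j; rewrite /n /Rmax; case: Rle_dec => ?; nra.
by move=> i; have := bnd i; nra.
Qed.

(** Picard iteration from 0. The scalar [N n] dominates the next increment of every component and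
    shrinks by the factor kappa, so each component converges by comparison with a geometric
    series. *)
Lemma fixpoint_exists L (G : 'I_I -> R -> R) r :
  (forall j, 0 <= L j) -> ksum L < 1 ->
  (forall j x y, Rabs (G j x - G j y) <= L j * Rabs (x - y)) ->
  exists e, forall i, e i = r i - rsum (fun j => K i j * G j (e j)).
Proof.
move=> L0 L1 GL.
pose T e i := r i - rsum (fun j => K i j * G j (e j)).
pose z n := iter n T (fun _ => 0).
pose N n := ksum (fun j => L j * Rabs (z n.+1 j - z n j)).
have zS n i : z n.+1 i = r i - rsum (fun j => K i j * G j (z n j)) by [].
have dT n i : Rabs (z n.+2 i - z n.+1 i) <= N n.
  rewrite (_ : _ - _ = rsum (fun j => K i j * (G j (z n j) - G j (z n.+1 j)))).
    by apply: Ksum_abs_le => j; rewrite (Rabs_minus_sym (z n.+1 j)); apply: GL.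
  by rewrite (zS n.+1) (zS n) (Ksum_minus i (fun j => G j (z n j)) (fun j => G j (z n.+1 j))); ring.
have kL0 := ksum_ge0 L0.
have N0 n : 0 <= N n by apply: ksum_ge0 => j; apply: Rmult_le_pos => //; apply: Rabs_pos.
have NS n : N n.+1 <= ksum L * N n.
  rewrite {1}/N Rmult_comm -ksum_scal; apply: ksum_le => j; rewrite Rmult_comm.
  by apply: Rmult_le_compat_r.
have NB n : N n <= ksum L ^ n * N 0%nat.
  elim: n => [|n IHn] /=; first lra.
  by apply: Rle_trans (NS n) _; rewrite Rmult_assoc; apply: Rmult_le_compat_l.
have cv i : ex_finite_lim_seq (fun n => z n.+1 i).
  have : ex_series (fun n => z n.+2 i - z n.+1 i).
    apply: (ex_series_le (V := R_CompleteNormedModule) _ (fun n => ksum L ^ n * N 0%nat)) => [n|].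
      by apply: Rle_trans (dT n i) (NB n).
    apply: ex_series_scal_r; apply: ex_series_geom; rewrite Rabs_pos_eq //.
  case=> s hs; exists (s + z 1%nat i).
  apply/is_lim_seq_incr_1.
  apply: (is_lim_seq_ext (fun n => sum_n (fun n => z n.+2 i - z n.+1 i) n + z 1%nat i)).
    elim=> [|n IHn]; first by rewrite sum_O; ring.
    by rewrite sum_Sn -[plus _ _]/(Rplus _ _) -IHn; ring.
  by apply: is_lim_seq_plus' => //; apply: is_lim_seq_const.
have [e he] : exists e : 'I_I -> R, forall i, is_lim_seq (fun n => z n.+1 i) (e i).
  have /constructive_indefinite_description [] //: exists e : 'I_I -> R, forall i, is_lim_seq (fun n => z n.+1 i) (e i).
    exists (fun i => real (Lim_seq (fun n => z n.+1 i))) => i.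
    by apply: Lim_seq_correct'.
  by move=> e; exists e.
exists e => i.
have lim2 : is_lim_seq (fun n => z n.+2 i) (e i) by apply/(is_lim_seq_incr_1 (fun n => z n.+1 i)).
suff lim2' : is_lim_seq (fun n => z n.+2 i) (T e i).
  by have [] := (is_lim_seq_unique _ _ lim2', is_lim_seq_unique _ _ lim2) => -> [].
have lim0 : is_lim_seq (fun n => ksum (fun j => L j * Rabs (z n.+1 j - e j))) 0.
  rewrite -[X in Rbar.Finite X](@rsum0 I (fun _ => 0)) //; apply: rsum_lim_seq => j.
  have := is_lim_seq_minus' _ _ _ _ (he j) (is_lim_seq_const (e j)).
  rewrite Rminus_diag => /is_lim_seq_abs_0 /(is_lim_seq_scal_l _ (2 * INR j.+1 * L j)) /=.
  rewrite Rmult_0_r => h; apply: (is_lim_seq_ext _ _ _ _ h) => n; ring.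
suff : is_lim_seq (fun n => z n.+2 i - T e i) 0.
  move=> h; have := is_lim_seq_plus' _ _ _ _ h (is_lim_seq_const (T e i)).
  by rewrite Rplus_0_l; apply: is_lim_seq_ext => n; ring.
apply/is_lim_seq_abs_0; apply: (is_lim_seq_le_le (fun _ => 0)) lim0 => [n|]; last exact: is_lim_seq_const.
split; first exact: Rabs_pos.
rewrite (zS n.+1) /T.
rewrite (_ : _ - _ = rsum (fun j => K i j * (G j (e j) - G j (z n.+1 j)))); last first.
  by rewrite (Ksum_minus i (fun j => G j (e j)) (fun j => G j (z n.+1 j))); ring.
by apply: Ksum_abs_le => j; rewrite (Rabs_minus_sym (z n.+1 j)); apply: GL.
Qed.

Lemma fixpoint_dist L (G : 'I_I -> R -> R) r r' e e' (B : R) :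
  (forall j, 0 <= L j) -> ksum L < 1 ->
  (forall j x y, Rabs (G j x - G j y) <= L j * Rabs (x - y)) ->
  (forall i, e i = r i - rsum (fun j => K i j * G j (e j))) ->
  (forall i, e' i = r' i - rsum (fun j => K i j * G j (e' j))) ->
  (forall i, Rabs (r i - r' i) <= B) ->
  forall i, Rabs (e i - e' i) <= B / (1 - ksum L).
Proof.
move=> L0 L1 GL eE eE' rB.
apply: (contraction (e := fun i => e i - e' i) (r := fun i => r i - r' i)
  (g := fun j => G j (e j) - G j (e' j)) L0 L1) => // i.
by rewrite {1}eE {1}eE' (Ksum_minus i (fun j => G j (e j)) (fun j => G j (e' j))); ring.
Qed.

Lemma fixpoint_unique L (G : 'I_I -> R -> R) r e e' :
  (forall j, 0 <= L j) -> ksum L < 1 ->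
  (forall j x y, Rabs (G j x - G j y) <= L j * Rabs (x - y)) ->
  (forall i, e i = r i - rsum (fun j => K i j * G j (e j))) ->
  (forall i, e' i = r i - rsum (fun j => K i j * G j (e' j))) ->
  forall i, e i = e' i.
Proof.
move=> L0 L1 GL eE eE' i.
have := @fixpoint_dist L G r r e e' 0 L0 L1 GL eE eE' _ i.
rewrite /Rdiv Rmult_0_l => h; apply: Rminus_diag_uniq.
have {}h : Rabs (e i - e' i) <= 0.
  by apply: h => j; rewrite Rminus_diag Rabs_R0; lra.
by have := Rabs_pos (e i - e' i); case: (Req_dec (e i - e' i) 0) => // /Rabs_pos_lt; lra.
Qed.

End Kernel.

(** * Fixed-point description of the map Upsilon *)

(** An element of the target space of Upsilon, extended by zero to the negative reals, together with
    bounds of its slopes. *)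
Definition slope_sys (I : nat) (L : 'I_I -> R) (F : 'I_I -> R -> R) : Prop :=
  [/\ forall j, 0 <= L j, ksum L < 1,
      forall j x y, x <= y -> 0 <= F j y - F j x <= L j * (y - x) &
      forall j x, x <= 0 -> F j x = 0].

Definition is_sol (I : nat) (F : 'I_I -> R -> R) (Z : 'I_I -> R -> R) : Prop :=
  forall i u, Z i u = u - rsum (fun j => K i j * F j (Z j u)).

(** The map phi_i of the zero-extended psi. It is the identity on negative reals, so that for psi in
    D it can be inverted on all of R. *)
Definition Phi (I : nat) (psi : 'I_I -> R -> R) (i : 'I_I) (u : R) : R :=
  u - rsum (fun j => K i j * ext0 (psi j) u).

Lemma ext0_ge0 f u : 0 <= u -> ext0 f u = f u.
Proof. by move=> u0; rewrite /ext0; case: Rlt_dec => // ?; lra. Qed.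

Lemma ext0_lt0 f u : u < 0 -> ext0 f u = 0.
Proof. by move=> u0; rewrite /ext0; case: Rlt_dec. Qed.

Lemma lip_cont_pos f C : 0 <= C ->
  (forall u v, 0 <= u -> 0 <= v -> Rabs (f u - f v) <= C * Rabs (u - v)) -> cont_pos f.
Proof.
move=> C0 fC u u0 eps eps0; exists (eps / (C + 1)).
have d0 : 0 < eps / (C + 1) by apply: Rdiv_lt_0_compat; lra.
split=> // v v0 vu; apply: Rle_lt_trans (fC _ _ v0 u0) _.
have e : eps = (C + 1) * (eps / (C + 1)) by field; lra.
by rewrite e; have := Rabs_pos (v - u); nra.
Qed.

Lemma lip_continuity f C : 0 <= C ->
  (forall u v, Rabs (f u - f v) <= C * Rabs (u - v)) -> continuity f.
Proof.
move=> C0 fC u eps eps0; exists (eps / (C + 1)).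
have d0 : 0 < eps / (C + 1) by apply: Rdiv_lt_0_compat; lra.
split=> // v [_ vu]; apply: Rle_lt_trans (fC _ _) _.
have e : eps = (C + 1) * (eps / (C + 1)) by field; lra.
by rewrite e; move: vu; rewrite /dist /= /Rdist; have := Rabs_pos (v - u); nra.
Qed.

Lemma slope_lip f C : (forall x y, x <= y -> 0 <= f y - f x <= C * (y - x)) ->
  forall x y, Rabs (f x - f y) <= C * Rabs (x - y).
Proof.
move=> fC x y; have [xy|yx] := Rle_dec x y.
  by rewrite Rabs_minus_sym (Rabs_minus_sym x) !Rabs_pos_eq; have := fC _ _ xy; lra.
by rewrite !Rabs_pos_eq; have := fC y x; lra.
Qed.

Lemma incr_surj f c : 0 < c ->
  (forall x y, x <= y -> c * (y - x) <= f y - f x <= y - x) -> f 0 = 0 ->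
  forall z, exists u, f u = z.
Proof.
move=> c0 fc f0 z.
have fcont : continuity f.
  apply: (@lip_continuity f 1); first lra.
  by apply: slope_lip => x y xy; have := fc _ _ xy; nra.
have zc : Rabs z = c * (Rabs z / c) by field; lra.
have zc0 : 0 <= Rabs z / c by apply: Rdiv_le_0_compat => //; apply: Rabs_pos.
have [] := @IVT_gen f (- (Rabs z / c)) (Rabs z / c) z fcont.
  have h1 := fc _ _ zc0; have h2 : - (Rabs z / c) <= 0 by lra.
  have {}h2 := fc _ _ h2; have [zl zr] := Rabs_le_between' z 0 (Rabs z).
  have := Rle_abs z; have := Rle_abs (- z); rewrite Rabs_Ropp => ? ?.
  by rewrite Rmin_left ?Rmax_right; nra.
by move=> u [_ fu]; exists u.
Qed.

(** Writing an increment of F as a non-negative coefficient times the increment of its argument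
    turns the difference of two nonlinear systems into a linear one, the form that [positivity]
    accepts. *)
Lemma slope_quot f C x y : 0 <= C -> (forall x y, x <= y -> 0 <= f y - f x <= C * (y - x)) ->
  exists l, 0 <= l <= C /\ f y - f x = l * (y - x).
Proof.
move=> C0 fC; have [->|xy] := Req_dec x y; first by exists 0; split; [lra|ring].
exists ((f y - f x) / (y - x)); split; last by field; lra.
have [lt|gt] : x < y \/ y < x by lra.
  have [lo hi] := fC _ _ (Rlt_le _ _ lt); split; first by apply: Rdiv_le_0_compat; lra.
  by apply/Rle_div_l; lra.
have [lo hi] := fC _ _ (Rlt_le _ _ gt).
rewrite (_ : _ / _ = (f x - f y) / (x - y)); last by field; lra.
split; first by apply: Rdiv_le_0_compat; lra.
by apply/Rle_div_l; lra.
Qed.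

Lemma fchoice (A B : Type) (P : A -> B -> Prop) :
  (forall a, exists b, P a b) -> exists f, forall a, P a (f a).
Proof.
move=> h; exists (fun a => proj1_sig (constructive_indefinite_description _ (h a))) => a.
by case: constructive_indefinite_description.
Qed.

Section System.
Context (I : nat).
Implicit Types (i j : 'I_I) (psi : 'I_I -> R -> R).

Section Sol.
Context (L : 'I_I -> R) (F Z : 'I_I -> R -> R).
Hypothesis HF : slope_sys L F.
Hypothesis HZ : is_sol F Z.

Lemma sys_lip j x y : Rabs (F j x - F j y) <= L j * Rabs (x - y).
Proof. by case: HF => L0 _ Fs _; apply: slope_lip => ? ?; apply: Fs. Qed.

(** The increments of Z solve a linear system with the slope quotients of F as coefficients and the
    constant right-hand side v - u, so [positivity] applies with d = v - u. *)
Lemma sol_slope i u v : u <= v -> (1 - ksum L) * (v - u) <= Z i v - Z i u <= v - u.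
Proof.
case: HF => L0 L1 Fs F0 uv.
have [l hl] := fchoice (fun j => @slope_quot (F j) (L j) (Z j u) (Z j v) (L0 j) (Fs j)).
apply: (@positivity I L (fun i => Z i v - Z i u) l) => [j|//||j]; first by case: (hl j).
  lra.
rewrite {1}HZ [X in _ - X = _]HZ.
rewrite (@rsum_ext _ (fun j0 => K j j0 * (l j0 * (Z j0 v - Z j0 u))) (fun j0 => K j j0 * (F j0 (Z j0 v) - F j0 (Z j0 u)))).
  rewrite (Ksum_minus j (fun j0 => F j0 (Z j0 v)) (fun j0 => F j0 (Z j0 u))); ring.
by move=> k; case: (hl k) => _ ->.
Qed.

Lemma sol_le0 i u : u <= 0 -> Z i u = u.
Proof.
case: HF => L0 L1 Fs F0 u0.
apply: (fixpoint_unique (G := F) (r := fun _ => u) (e := fun i => Z i u) (e' := fun _ => u) L0 L1 sys_lip) => // k.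
by rewrite rsum0 => [|j]; [ring|rewrite F0 //; ring].
Qed.

Lemma sol_ge0 i u : 0 <= u -> 0 <= Z i u.
Proof.
move=> u0; have := sol_slope i u0; rewrite (@sol_le0 i 0); last lra.
by case: HF => _ L1 _ _; nra.
Qed.

Lemma sol_lt0 i u : u < 0 -> Z i u < 0.
Proof. by move=> u0; rewrite sol_le0; lra. Qed.

Lemma sol_surj i z : exists u, Z i u = z.
Proof.
case: (HF) => _ L1 _ _; apply: (@incr_surj _ (1 - ksum L)); first lra.
  by move=> x y; apply: sol_slope.
by apply: sol_le0; lra.
Qed.

Lemma sol_surj_pos i z : 0 <= z -> exists u, 0 <= u /\ Z i u = z.
Proof.
move=> z0; have [u uz] := sol_surj i z; exists u; split=> //.
by case: (Rle_dec 0 u) => // nu; have := @sol_lt0 i u; lra.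
Qed.

Lemma sol_phi i u : phi (fun i u => F i (Z i u)) i u = Z i u.
Proof. by rewrite phiE [RHS]HZ. Qed.

Lemma sol_inj i u v : Z i u = Z i v -> u = v.
Proof.
case: (HF) => _ L1 _ _ e; have [lt|gt] := Rle_dec u v; first by have := sol_slope i lt; nra.
by have := @sol_slope i v u; nra.
Qed.

(** Here phi_i is Z_i itself, so the quotients in the definition of D are slope quotients of F_i,
    bounded by L_i. *)
Lemma sol_InD : InD (fun i u => F i (Z i u)).
Proof.
case: (HF) => L0 L1 Fs F0.
have ZL i u v : Rabs (Z i u - Z i v) <= 1 * Rabs (u - v).
  by apply: slope_lip => x y xy; have := sol_slope i xy; nra.
split; [move=> i|split].
- split; [|split; [|split]].
  + by rewrite F0 // sol_le0; lra.
  + by move=> u u0; have := Fs i 0 _ (sol_ge0 i u0); rewrite (F0 i 0); lra.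
  + apply: (lip_cont_pos (L0 i)) => u v _ _; apply: Rle_trans (sys_lip i _ _) _.
    by apply: Rmult_le_compat_l => //; have := ZL i u v; lra.
  + move=> u v u0 uv; suff /(Fs i) : Z i u <= Z i v by lra.
    by have := sol_slope i uv; nra.
- move=> i _; split; [split; [|split; [|split]]|split].
  + by rewrite sol_phi sol_le0; lra.
  + by move=> u u0; rewrite sol_phi; apply: sol_ge0.
  + apply: (@lip_cont_pos _ 1) => [|u v _ _]; first lra.
    by rewrite !sol_phi.
  + by move=> u v u0 uv; rewrite !sol_phi; have := sol_slope i uv; nra.
  + by move=> u v u0 uv; rewrite !sol_phi; have := sol_slope i (Rlt_le _ _ uv); nra.
  + move=> M; exists (Rmax 0 (M / (1 - ksum L))); split=> [|u]; first exact: Rmax_l.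
    move=> uM; rewrite sol_phi; have u0 := Rle_trans _ _ _ (Rmax_l _ _) uM.
    have /Rle_div_l {}uM := Rle_trans _ _ _ (Rmax_r _ _) uM.
    have := sol_slope i u0; rewrite (@sol_le0 i 0); last lra.
    have : M <= u * (1 - ksum L) by apply: uM; lra.
    lra.
exists L; split=> [|i u1 u2 p1 p2 ne].
  by have := wsum_ksum L; lra.
rewrite !sol_phi; have neZ : Z i u1 - Z i u2 <> 0 by move=> /Rminus_diag_uniq /sol_inj.
have [l [[l0 lL] ->]] := slope_quot (Z i u2) (Z i u1) (L0 i) (Fs i).
by rewrite /Rdiv Rmult_assoc Rinv_r //; lra.
Qed.

(** Whichever non-negative preimage v of z is picked by [inv_pos], psi_i v = F_i (phi_i v) = F_i
    z. *)
Lemma sol_Upsilon psi i z : (forall i u, 0 <= u -> psi i u = F i (Z i u)) ->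
  0 <= z -> Upsilon psi i z = F i z.
Proof.
move=> psiE z0; have [u [u0 uz]] := sol_surj_pos i z0.
have phiZ v : 0 <= v -> phi psi i v = Z i v.
  by move=> v0; rewrite phiE HZ; congr (_ - _); apply: rsum_ext => j; rewrite psiE.
have [] := epsilon_spec (inhabits 0) (fun v => 0 <= v /\ phi psi i v = z).
  by exists u; rewrite phiZ.
rewrite -/(inv_pos (phi psi i) z) => v0 vz.
by rewrite /Upsilon psiE // -phiZ // vz.
Qed.

End Sol.

(** F_i is the zero-extended psi_i composed with the inverse of [Phi psi i]. The work lies in a
    positive lower bound for the slope of [Phi], which makes this inverse available on all of R. *)
Lemma InD_sys psi : InD psi ->
  exists L F, slope_sys L F /\ forall i u, F i (Phi psi i u) = ext0 (psi i) u.
Proof.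
case=> psiC [phiI [L [Lw psiL]]].
have psi0 i : psi i 0 = 0 by case: (psiC i).
have psim i u v : 0 <= u -> u <= v -> psi i u <= psi i v by case: (psiC i) => _ [_ [_ h]]; apply: h.
have L1 : ksum L < 1 by rewrite wsum_ksum; lra.
(* Strict monotonicity is given for phi_I only. It passes to phi_i because phi_i - phi_I is the sum
   of (K_Im - K_im) psi_m, whose coefficients are non-negative and whose psi_m are
   non-decreasing. *)
have philt i u v : 0 <= u -> u < v -> 0 < phi psi i v - phi psi i u.
  case: I psi i psiC phiI L Lw psiL psi0 psim {L1} => [|n] psi' i _ phiI _ _ _ _ psim u0 uv; first by case: i.
  have [_ [phii _]] := phiI ord_max (erefl _).
  have := phii u v u0 uv; rewrite !phiE => h.
  have : 0 <= rsum (fun m => (K ord_max m - K i m) * (psi' m v - psi' m u)).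
    apply: rsum_ge0 => j; apply: Rmult_le_pos; last by have := psim j u v u0; lra.
    suff : INR (minn i.+1 j.+1) <= INR (minn n.+1 j.+1) by rewrite /K /=; lra.
    apply/le_INR/leP; rewrite leq_min geq_minr andbT; apply: leq_trans (geq_minl _ _) _.
    exact: ltn_ord.
  rewrite (rsum_ext (g := fun m => (K ord_max m * psi' m v - K ord_max m * psi' m u) - (K i m * psi' m v - K i m * psi' m u))); last by move=> m; ring.
  by rewrite !rsum_minus; lra.
have L0 i : 0 <= L i.
  apply: Rle_trans (psiL i 1 0 _ _ _); try lra.
  have := philt i 0 1; have := psim i 0 1 => *.
  by apply: Rdiv_le_0_compat; lra.
have psle i u v : 0 <= u -> u <= v -> psi i v - psi i u <= L i * (phi psi i v - phi psi i u).
  move=> u0 [uv|->]; last lra.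
  have := psiL i v u _ u0 _; have := philt i u v u0 uv => pv psiq.
  by apply/Rle_div_l => //; apply: psiq; lra.
(* The quotients of psi by phi are the coefficients of a linear system for the increments of phi;
   [positivity] upgrades strict monotonicity to a quantitative slope. *)
have phislope i u v : 0 <= u -> u <= v ->
    (1 - ksum L) * (v - u) <= phi psi i v - phi psi i u <= v - u.
  move=> u0 uv.
  have [l hl] : exists l, forall j, 0 <= l j <= L j /\
      psi j v - psi j u = l j * (phi psi j v - phi psi j u).
    apply: (fchoice (P := fun j l => 0 <= l <= L j /\
      psi j v - psi j u = l * (phi psi j v - phi psi j u))) => j.
    case: (Rle_lt_or_eq_dec _ _ uv) => [lt|->]; last by exists 0; split; [have := L0 j; lra|ring].
    have pl := philt j u v u0 lt.
    exists ((psi j v - psi j u) / (phi psi j v - phi psi j u)); split; last by field; lra.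
    split; first by apply: Rdiv_le_0_compat => //; have := psim j u v u0; lra.
    by apply: psiL; lra.
  apply: (@positivity I L (fun i => phi psi i v - phi psi i u) l) => [j|//||j]; first by case: (hl j).
    lra.
  rewrite [phi psi j v]phiE [phi psi j u]phiE.
  rewrite (@rsum_ext _ (fun k => K j k * (l k * _)) (fun k => K j k * (psi k v - psi k u))).
    rewrite (Ksum_minus j (fun k => psi k v) (fun k => psi k u)); ring.
  by move=> k; case: (hl k) => _ ->.
have PhiP i u : 0 <= u -> Phi psi i u = phi psi i u.
  by move=> u0; rewrite phiE; congr (_ - _); apply: rsum_ext => j; rewrite ext0_ge0.
have PhiN i u : u < 0 -> Phi psi i u = u.
  by move=> u0; rewrite /Phi rsum0 => [|j]; [ring|rewrite ext0_lt0 //; ring].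
have phi0 i : phi psi i 0 = 0.
  by rewrite phiE rsum0 => [|j]; [ring|rewrite psi0; ring].
have Phislope i u v : u <= v -> (1 - ksum L) * (v - u) <= Phi psi i v - Phi psi i u <= v - u.
  have k0 := ksum_ge0 L0.
  move=> uv; have [u0|u0] := Rle_lt_dec 0 u.
    by rewrite !PhiP; [apply: phislope|lra|lra].
  have [v0|v0] := Rle_lt_dec 0 v; last by rewrite !PhiN //; nra.
  rewrite (PhiN i u) // (PhiP i v) //; have := phislope i 0 v (Rle_refl 0) v0; rewrite phi0; nra.
have extslope i u v : u <= v -> 0 <= ext0 (psi i) v - ext0 (psi i) u <= L i * (Phi psi i v - Phi psi i u).
  move=> uv; have [u0|u0] := Rle_lt_dec 0 u.
    rewrite !ext0_ge0 ?PhiP; try lra; split; last exact: psle.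
    by have := psim i u v u0 uv; lra.
  have := Phislope i u v uv => Ps.
  have [v0|v0] := Rle_lt_dec 0 v; last first.
    rewrite !ext0_lt0 // Rminus_diag; split; first lra.
    by apply: Rmult_le_pos => //; nra.
  rewrite (ext0_ge0 _ v0) (ext0_lt0 _ u0) (PhiN i u) // (PhiP i v) //.
  have := psle i 0 v (Rle_refl 0) v0; have := psim i 0 v (Rle_refl 0) v0.
  by rewrite phi0 psi0; have := L0 i; nra.
have [g hg] : exists g : 'I_I -> R -> R, forall i z, Phi psi i (g i z) = z.
  apply: (fchoice (P := fun i gi => forall z, Phi psi i (gi z) = z)) => i.
  apply: (fchoice (P := fun z u => Phi psi i u = z)); apply: (@incr_surj _ (1 - ksum L)); first lra.
    by move=> x y; apply: Phislope.
  by rewrite PhiP ?phi0 //; lra.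
have Phiinj i u v : Phi psi i u = Phi psi i v -> u = v.
  move=> e; have [uv|vu] := Rle_dec u v; first by have := Phislope i u v uv; nra.
  by have := Phislope i v u; nra.
exists L, (fun i z => ext0 (psi i) (g i z)); split; last first.
  by move=> i u; congr ext0; apply: (Phiinj i); rewrite hg.
split=> // [j x y xy|j x x0].
  have gxy : g j x <= g j y.
    case: (Rle_dec (g j x) (g j y)) => // gt.
    by have := Phislope j (g j y) (g j x); rewrite !hg; nra.
  by have := extslope j _ _ gxy; rewrite !hg.
have : g j x <= 0.
  case: (Rle_dec (g j x) 0) => // gt.
  by have := Phislope j 0 (g j x); rewrite hg PhiP ?phi0; nra.
case=> [|->]; first exact: ext0_lt0.
by rewrite ext0_ge0 ?psi0 //; lra.
Qed.

Lemma Phi_sol psi F : (forall i u, F i (Phi psi i u) = ext0 (psi i) u) -> is_sol F (Phi psi).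
Proof. by move=> h i u; rewrite {1}/Phi; congr (_ - _); apply: rsum_ext => j; rewrite h. Qed.

(** This is the bijectivity of Upsilon as it is needed. [sol_InD] supplies a preimage, so the choice
    is meaningful; any chosen preimage has its own system F', which agrees with F, and uniqueness of
    the fixed point identifies its [Phi] with Z. *)
Lemma Upsilon_invP psi' pb L F Z : slope_sys L F -> is_sol F Z ->
  (forall i z, 0 <= z -> pb i z = F i z) -> psi' = Upsilon_inv pb ->
  InD psi' /\ forall i u, 0 <= u -> psi' i u = F i (Z i u).
Proof.
move=> HF HZ pbF psiE.
have [|psiD psiU] := epsilon_spec (inhabits (fun (_ : 'I_I) (_ : R) => 0))
  (fun psi => InD psi /\ forall i z, 0 <= z -> Upsilon psi i z = pb i z).
  exists (fun i u => F i (Z i u)); split; first exact: sol_InD HF HZ.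
  by move=> i z z0; rewrite pbF //; apply: (sol_Upsilon HF HZ).
move: psiD psiU; rewrite -/(Upsilon_inv pb) -psiE => psiD psiU; split=> //.
have [L' [F' [HF' F'E]]] := InD_sys psiD.
have FF' i z : F' i z = F i z.
  have [z0|z0] := Rle_lt_dec 0 z; last first.
    by case: HF HF' => _ _ _ Fz [_ _ _ Fz']; rewrite Fz ?Fz'; lra.
  rewrite -pbF // -psiU // (sol_Upsilon HF' (Phi_sol F'E)) // => j u u0.
  by rewrite F'E ext0_ge0.
move=> i u u0; rewrite -(ext0_ge0 (psi' i) u0) -F'E FF'; congr F.
case: (HF) => L0 L1 _ _.
apply: (fixpoint_unique (G := F) (r := fun _ => u) (e := fun i => Phi psi' i u)
  (e' := fun i => Z i u) L0 L1 (sys_lip HF)) => k; last exact: HZ.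
by rewrite {1}(Phi_sol F'E); congr (_ - _); apply: rsum_ext => j; rewrite FF'.
Qed.

(** Y_i stands for phi_i(u, t) - i t, the label of the level curve through (u, t); a negative label
    means that the curve entered through u = 0. *)
Definition is_Y (F : 'I_I -> R -> R) (Y : 'I_I -> R -> R -> R) : Prop :=
  forall i u t, Y i u t = u - INR i.+1 * t - rsum (fun j => K i j * F j (Y j u t)).

Lemma slope_sys_shift L F t : 0 <= t -> slope_sys L F ->
  slope_sys L (fun j z => F j (z - INR j.+1 * t)).
Proof.
move=> t0 [L0 L1 Fs F0]; split=> // [j x y xy|j x x0].
  by have := Fs j (x - INR j.+1 * t) (y - INR j.+1 * t); lra.
by apply: F0; have := pos_INR j.+1; nra.
Qed.

(** At a fixed time, adding i t back gives the phi of the translated functions, so all results on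
    [is_sol] apply to each time slice of Y. *)
Lemma is_Y_sol F Y t : is_Y F Y ->
  is_sol (fun j z => F j (z - INR j.+1 * t)) (fun i u => Y i u t + INR i.+1 * t).
Proof.
move=> HY i u; rewrite HY.
rewrite (@rsum_ext _ (fun j => K i j * F j (Y j u t + _ - _)) (fun j => K i j * F j (Y j u t))); first ring.
by move=> j; congr (_ * F _ _); ring.
Qed.

Lemma is_Y_exists L F : slope_sys L F -> exists Y, is_Y F Y.
Proof.
move=> HF; case: (HF) => L0 L1 _ _.
have [Y hY] := fchoice (fun p : R * R => @fixpoint_exists _ L F (fun i => p.1 - INR i.+1 * p.2) L0 L1 (sys_lip HF)).
by exists (fun i u t => Y (u, t) i) => i u t; apply: hY.
Qed.

Lemma theta_sys psi0 L F t i z : slope_sys L F -> (forall i u, F i (Phi psi0 i u) = ext0 (psi0 i) u) ->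
  0 <= z -> theta t (Upsilon psi0) i z = F i (z - INR i.+1 * t).
Proof.
move=> HF F0 z0; rewrite /theta (sol_Upsilon HF (Phi_sol F0)).
- rewrite /Rmax; case: Rle_dec => // h; case: (HF) => _ _ _ Fz.
  by rewrite !Fz //; lra.
- by move=> j u u0; rewrite F0 ext0_ge0.
- exact: Rmax_r.
Qed.

Lemma psi_solE psi0 L F Y t : slope_sys L F ->
  (forall i u, F i (Phi psi0 i u) = ext0 (psi0 i) u) -> is_Y F Y -> 0 <= t ->
  InD (fun i u => psi_sol psi0 i u t) /\
  forall i u, 0 <= u -> psi_sol psi0 i u t = F i (Y i u t).
Proof.
move=> HF F0 HY t0.
have [D E] := @Upsilon_invP (fun i u => psi_sol psi0 i u t) _ L _ _
  (slope_sys_shift t0 HF) (is_Y_sol t HY) (fun i z => @theta_sys psi0 L F t i z HF F0) (erefl _).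
by split=> // i u u0; rewrite E //; congr F; ring.
Qed.

End System.

(** * Differentiation of contractive systems *)

Lemma lim_bounds f c C x l :
  (forall x y, x <= y -> c * (y - x) <= f y - f x <= C * (y - x)) ->
  derivable_pt_lim f x l -> c <= l <= C.
Proof.
move=> fc fl.
have key eps : 0 < eps -> c - eps < l < C + eps.
  move=> e0; have [[d d0] hd] := fl eps e0.
  have dd : 0 < d / 2 by lra.
  have := hd (d / 2); rewrite Rabs_pos_eq /=; last lra.
  move=> /(_ (Rgt_not_eq _ _ dd)) /(_ ltac:(lra)) /Rabs_lt_between.
  have := fc x (x + d / 2); rewrite (_ : x + d / 2 - x = d / 2); last ring.
  move=> /(_ ltac:(lra)) [lo hi].
  have : c <= (f (x + d / 2) - f x) / (d / 2) by apply/Rle_div_r; lra.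
  have : (f (x + d / 2) - f x) / (d / 2) <= C by apply/Rle_div_l; lra.
  lra.
split; apply: Rnot_lt_le => h.
  by have := key (c - l); lra.
by have := key (l - C); lra.
Qed.

Lemma inverse_lip f g c : 0 < c ->
  (forall x y, x <= y -> c * (y - x) <= f y - f x) -> (forall z, f (g z) = z) ->
  forall z z', Rabs (g z - g z') <= / c * Rabs (z - z').
Proof.
move=> c0 fc fg z z'.
apply: (Rmult_le_reg_l c) => //; rewrite -Rmult_assoc Rinv_r ?Rmult_1_l; last lra.
rewrite -{2}(fg z) -{2}(fg z').
have [h|h] := Rle_lt_dec (g z) (g z').
  rewrite Rabs_minus_sym (Rabs_minus_sym (f _)); have := fc _ _ h => h'.
  by rewrite !Rabs_pos_eq; nra.
have := fc _ _ (Rlt_le _ _ h) => h'.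
by rewrite !Rabs_pos_eq; nra.
Qed.

(** With k = g (z + h) - g z, the quotient k / h is the inverse of a difference quotient of f, and
    |k| <= |h| / c makes k small with h. *)
Lemma inverse_lim f g c z w : 0 < c ->
  (forall x y, x <= y -> c * (y - x) <= f y - f x) -> (forall z, f (g z) = z) ->
  0 < w -> derivable_pt_lim f (g z) w -> derivable_pt_lim g z (/ w).
Proof.
move=> c0 fc fg w0 fw eps e0.
have [|[d d0] hd] := fw (eps * c * w); first by do 2 (apply: Rmult_lt_0_compat => //).
have gl := inverse_lip c0 fc fg.
have dc : 0 < d * c by apply: Rmult_lt_0_compat.
exists (mkposreal _ dc) => h h0 /= hdc.
set k := g (z + h) - g z.
have hk : h = f (g z + k) - f (g z) by rewrite /k Rplus_minus !fg; ring.
have k0 : k <> 0 by move=> k0; apply: h0; rewrite hk k0 Rplus_0_r; ring.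
have kh : Rabs k <= / c * Rabs h by apply: Rle_trans (gl _ _) _; right; congr (_ * Rabs _); ring.
have kd : Rabs k < d.
  apply: Rle_lt_trans kh _; apply: (Rmult_lt_reg_l c) => //.
  by rewrite -Rmult_assoc Rinv_r ?Rmult_1_l; lra.
have /= := hd k k0 kd; rewrite -hk => hkw.
rewrite (_ : k / h - / w = (w - h / k) * (k / h * / w)); last by field; split; lra.
rewrite Rabs_mult (Rabs_mult (k / h)) Rabs_minus_sym (Rabs_pos_eq (/ w)); last by apply: Rlt_le; apply: Rinv_0_lt_compat.
have hp := Rabs_pos_lt _ h0.
have q : Rabs (k / h) <= / c by rewrite Rabs_div //; apply/Rle_div_l.
have iw := Rinv_0_lt_compat _ w0; have ic := Rinv_0_lt_compat _ c0.
have qi : Rabs (k / h) * / w <= / c * / w by apply: Rmult_le_compat_r => //; lra.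
apply: Rle_lt_trans (Rmult_le_compat_l _ _ _ (Rabs_pos _) qi) _.
apply: Rlt_le_trans (Rmult_lt_compat_r _ _ _ _ hkw) _; first exact: Rmult_lt_0_compat.
by right; field; lra.
Qed.

Lemma rsum_continuity (I : nat) (f : 'I_I -> R -> R) :
  (forall i, continuity (f i)) -> continuity (fun x => rsum (fun i => f i x)).
Proof.
move=> cf x; rewrite /rsum; elim: (index_enum _) => [|i s IHs].
  apply: (continuity_pt_ext (fun _ => 0)) => [u|]; first by rewrite big_nil.
  exact: continuity_pt_const.
apply: (continuity_pt_ext (fun u => f i u + (\sum_(j <- s) f j u)%R)).
  by move=> u; rewrite big_cons.
by apply: continuity_pt_plus => //; apply: cf.
Qed.

Section Regularity.
Context (I : nat).
Implicit Types (i j : 'I_I).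
Context (psi : 'I_I -> R -> R) (L : 'I_I -> R) (F : 'I_I -> R -> R) (p : 'I_I -> R -> R).
Hypothesis HF : slope_sys L F.
Hypothesis FPhi : forall i u, F i (Phi psi i u) = ext0 (psi i) u.
Hypothesis psip : forall i x, derivable_pt_lim (ext0 (psi i)) x (p i x).
Hypothesis pcont : forall i, continuity (p i).

Definition Phi' i (u : R) := 1 - rsum (fun j => K i j * p j u).

Lemma Phi_lim i u : derivable_pt_lim (Phi psi i) u (Phi' i u).
Proof.
apply: (derivable_pt_lim_minus id); first exact: derivable_pt_lim_id.
apply: (@rsum_lim _ _ (fun j u => K i j * ext0 (psi j) u)) => j.
exact: (derivable_pt_lim_scal (ext0 (psi j))).
Qed.

Lemma Phi'_bounds i u : 1 - ksum L <= Phi' i u <= 1.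
Proof.
apply: (lim_bounds _ (Phi_lim i u)) => x y xy.
by have := sol_slope HF (Phi_sol FPhi) i xy; lra.
Qed.

Lemma Phi'_cont i : continuity (Phi' i).
Proof.
move=> x; apply: (continuity_pt_minus (fun _ => 1)); first exact: continuity_pt_const.
apply: (@rsum_continuity _ (fun j u => K i j * p j u)) => j y.
by apply: (continuity_pt_scal (p j)); apply: pcont.
Qed.

(** F is the zero-extended psi composed with g, the inverse of [Phi], so f = (p / Phi') o g. The
    second-order clause sits in the same statement because it must concern this very [f]. *)
Lemma sys_C1 : exists f, [/\ forall i x, derivable_pt_lim (F i) x (f i x),
  forall i, continuity (f i) & 
  forall q, (forall i x, derivable_pt_lim (p i) x (q i x)) -> (forall i, continuity (q i)) ->
    exists f2, (forall i x, derivable_pt_lim (f i) x (f2 i x)) /\ forall i, continuity (f2 i)].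
Proof.
case: (HF) => L0 L1 _ _.
have c0 : 0 < 1 - ksum L by lra.
have [g hg] : exists g : 'I_I -> R -> R, forall i z, Phi psi i (g i z) = z.
  apply: (fchoice (P := fun i gi => forall z, Phi psi i (gi z) = z)) => i.
  exact: (fchoice (fun z => sol_surj HF (Phi_sol FPhi) i z)).
have slope i x y : x <= y -> (1 - ksum L) * (y - x) <= Phi psi i y - Phi psi i x.
  by move=> xy; have := sol_slope HF (Phi_sol FPhi) i xy; lra.
have W0 i u : 0 < Phi' i u by have := Phi'_bounds i u; lra.
have glim i z : derivable_pt_lim (g i) z (/ Phi' i (g i z)).
  exact: (inverse_lim c0 (slope i) (hg i) (W0 i _) (Phi_lim i _)).
have gcont i : continuity (g i).
  apply: (@lip_continuity _ (/ (1 - ksum L))).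
    by apply: Rlt_le; apply: Rinv_0_lt_compat.
  exact: (inverse_lip c0 (slope i) (hg i)).
have comp_cont i h : continuity h -> continuity (fun z => h (g i z)).
  by move=> hc z; apply: (continuity_pt_comp (g i) h); [apply: gcont|apply: hc].
have W_ne i z : Phi' i (g i z) <> 0 by have := W0 i (g i z); lra.
exists (fun i z => p i (g i z) / Phi' i (g i z)); split=> [i x|i|q pq qc].
- have FE : forall z, ext0 (psi i) (g i z) = F i z by move=> z; rewrite -FPhi hg.
  apply/is_derive_Reals; apply: (is_derive_ext _ _ _ _ FE); apply/is_derive_Reals.
  exact: (derivable_pt_lim_comp (g i) (ext0 (psi i))).
- move=> z; apply: (continuity_pt_div (fun z => p i (g i z)) (fun z => Phi' i (g i z))) => //.
    exact: comp_cont.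
  by apply: comp_cont; apply: Phi'_cont.
pose W2 i u := 0 - rsum (fun j => K i j * q j u).
have W2lim i u : derivable_pt_lim (Phi' i) u (W2 i u).
  apply: (derivable_pt_lim_minus (fun _ => 1)); first exact: derivable_pt_lim_const.
  apply: (@rsum_lim _ _ (fun j u => K i j * p j u)) => j.
  exact: (derivable_pt_lim_scal (p j)).
have W2c i : continuity (W2 i).
  move=> x; apply: (continuity_pt_minus (fun _ => 0)); first exact: continuity_pt_const.
  apply: (@rsum_continuity _ (fun j u => K i j * q j u)) => j y.
  by apply: (continuity_pt_scal (q j)); apply: qc.
pose h i u := (q i u * Phi' i u - W2 i u * p i u) / Rsqr (Phi' i u).
exists (fun i z => h i (g i z) * / Phi' i (g i z)); split=> [i x|i].
  apply: (derivable_pt_lim_comp (g i) (fun u => p i u / Phi' i u)) => //.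
  by apply: (derivable_pt_lim_div (p i) (Phi' i)) => //; have := W0 i (g i x); lra.
have hc : continuity (h i).
  move=> u; apply: (continuity_pt_div (fun u => q i u * Phi' i u - W2 i u * p i u) (fun u => Rsqr (Phi' i u))).
  - apply: (continuity_pt_minus (fun u => q i u * Phi' i u) (fun u => W2 i u * p i u)).
      by apply: continuity_pt_mult; [apply: qc|apply: Phi'_cont].
    by apply: continuity_pt_mult; [apply: W2c|apply: pcont].
  - by apply: (continuity_pt_mult (Phi' i)); apply: Phi'_cont.
  by apply: Rgt_not_eq; apply: Rlt_0_sqr; have := W0 i u; lra.
move=> z; apply: (continuity_pt_mult (fun z => h i (g i z)) (fun z => / Phi' i (g i z))).
  exact: comp_cont.
apply: (continuity_pt_inv (fun z => Phi' i (g i z))) => //.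
by apply: comp_cont; apply: Phi'_cont.
Qed.

End Regularity.

(** * Differential calculus in the plane *)

Lemma diff_add x y : differentiable_pt_lim Rplus x y 1 1.
Proof.
move=> eps; exists eps => u v _ _.
rewrite (_ : _ - _ = 0) ?Rabs_R0; last ring.
by apply: Rmult_le_pos; [case: eps => e /=; lra|apply: Rle_trans (Rabs_pos _) (Rmax_l _ _)].
Qed.

Lemma diff_mul x y : differentiable_pt_lim Rmult x y y x.
Proof.
move=> eps; exists eps => u v ux vy.
rewrite (_ : _ - _ = (u - x) * (v - y)); last ring.
rewrite Rabs_mult; apply: Rmult_le_compat; try exact: Rabs_pos; last exact: Rmax_r.
exact: Rlt_le.
Qed.

Lemma diff_eq f x y a b a' b' : differentiable_pt_lim f x y a b -> a = a' -> b = b' ->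
  differentiable_pt_lim f x y a' b'.
Proof. by move=> + <- <-. Qed.

Lemma diff_ext f g x y a b : (forall u v, f u v = g u v) ->
  differentiable_pt_lim f x y a b -> differentiable_pt_lim g x y a b.
Proof. by move=> fg; apply: differentiable_pt_lim_ext; exists (mkposreal _ Rlt_0_1). Qed.

Lemma diff_plus f g x y a b a' b' :
  differentiable_pt_lim f x y a b -> differentiable_pt_lim g x y a' b' ->
  differentiable_pt_lim (fun u v => f u v + g u v) x y (a + a') (b + b').
Proof. by move=> hf hg; refine (diff_eq (differentiable_pt_lim_comp _ _ _ _ _ _ _ _ _ _ _ (diff_add _ _) hf hg) _ _); ring. Qed.

Lemma diff_mult f g x y a b a' b' :
  differentiable_pt_lim f x y a b -> differentiable_pt_lim g x y a' b' ->
  differentiable_pt_lim (fun u v => f u v * g u v) x y (g x y * a + f x y * a') (g x y * b + f x y * b').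
Proof. by move=> hf hg; refine (diff_eq (differentiable_pt_lim_comp _ _ _ _ _ _ _ _ _ _ _ (diff_mul _ _) hf hg) _ _); ring. Qed.

Lemma diff_const c x y : differentiable_pt_lim (fun _ _ => c) x y 0 0.
Proof. exact: (differentiable_pt_lim_proj1_0 _ _ _ _ (derivable_pt_lim_const c x)). Qed.

Lemma diff_scal c f x y a b :
  differentiable_pt_lim f x y a b -> differentiable_pt_lim (fun u v => c * f u v) x y (c * a) (c * b).
Proof. by move=> hf; apply: (diff_eq (diff_mult (diff_const c x y) hf)); ring. Qed.

Lemma diff_affine A B C x y : differentiable_pt_lim (fun u v => A * u + B * v + C) x y A B.
Proof.
move=> eps; exists eps => u v _ _.
rewrite (_ : _ - _ = 0) ?Rabs_R0; last ring.
by apply: Rmult_le_pos; [case: eps => e /=; lra|apply: Rle_trans (Rabs_pos _) (Rmax_l _ _)].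
Qed.

Lemma diff_comp h f x y l a b : derivable_pt_lim h (f x y) l ->
  differentiable_pt_lim f x y a b ->
  differentiable_pt_lim (fun u v => h (f u v)) x y (l * a) (l * b).
Proof.
move=> hl hf.
by refine (diff_eq (differentiable_pt_lim_comp _ _ _ _ _ _ _ _ _ _ _ (@differentiable_pt_lim_proj1_0 h _ 0 l hl) hf (diff_const 0 x y)) _ _); ring.
Qed.

(** Since f vanishes at the point, variations of s contribute only at second order, so continuity of
    s suffices. This permits differentiating linear systems whose solution is so far only known to
    be continuous. *)
Lemma diff_mult_cont f s x y a b : differentiable_pt_lim f x y a b -> f x y = 0 ->
  continuity_2d_pt s x y ->
  differentiable_pt_lim (fun u v => f u v * s u v) x y (a * s x y) (b * s x y).
Proof.
move=> hf f0 hs eps.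
set M := Rabs (s x y) + 1; set N := Rabs a + Rabs b + 1.
have M0 : 0 < M by rewrite /M; have := Rabs_pos (s x y); lra.
have N0 : 0 < N by rewrite /N; have := Rabs_pos a; have := Rabs_pos b; lra.
have e1 : 0 < eps / (2 * M) by apply: Rdiv_lt_0_compat; [exact: cond_pos|lra].
have e2 : 0 < Rmin 1 (eps / (2 * N)).
  by apply: Rmin_glb_lt; [lra|apply: Rdiv_lt_0_compat; [exact: cond_pos|lra]].
apply: (locally_2d_impl _ _ _ _ _ (hf (mkposreal _ e1))).
apply: (locally_2d_impl _ _ _ _ _ (hs (mkposreal _ e2))).
apply: locally_2d_forall => u v /= sv fv.
rewrite f0 in fv *; set m := Rmax _ _ in fv *.
have m0 : 0 <= m by apply: Rle_trans (Rabs_pos _) (Rmax_l _ _).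
rewrite (_ : _ - _ = s u v * (f u v - 0 - (a * (u - x) + b * (v - y)))
  + (s u v - s x y) * (a * (u - x) + b * (v - y))); last ring.
apply: Rle_trans (Rabs_triang _ _) _; rewrite !Rabs_mult.
have [s1 s2] : Rabs (s u v - s x y) < 1 /\ Rabs (s u v - s x y) < eps / (2 * N).
  by split; apply: Rlt_le_trans sv _; [apply: Rmin_l|apply: Rmin_r].
have sM : Rabs (s u v) <= M.
  have := Rabs_triang (s u v - s x y) (s x y).
  by rewrite (_ : s u v - s x y + s x y = s u v) /M; [lra|ring].
have lN : Rabs (a * (u - x) + b * (v - y)) <= N * m.
  apply: Rle_trans (Rabs_triang _ _) _; rewrite !Rabs_mult.
  have ha : Rabs a * Rabs (u - x) <= Rabs a * m by apply: Rmult_le_compat_l; [apply: Rabs_pos|apply: Rmax_l].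
  have hb : Rabs b * Rabs (v - y) <= Rabs b * m by apply: Rmult_le_compat_l; [apply: Rabs_pos|apply: Rmax_r].
  by rewrite /N; lra.
have -> : eps * m = M * (eps / (2 * M) * m) + eps / (2 * N) * (N * m) by field; lra.
by apply: Rplus_le_compat; apply: Rmult_le_compat; try exact: Rabs_pos => //; lra.
Qed.

Lemma rsum_diff (I : nat) (f : 'I_I -> R -> R -> R) x y (a b : 'I_I -> R) :
  (forall i, differentiable_pt_lim (f i) x y (a i) (b i)) ->
  differentiable_pt_lim (fun u v => rsum (fun i => f i u v)) x y (rsum a) (rsum b).
Proof.
move=> hf; rewrite /rsum; elim: (index_enum _) => [|i s IHs].
  by rewrite !big_nil; apply: (diff_ext _ (diff_const 0 x y)) => u v; rewrite big_nil.
rewrite !big_cons; apply: (diff_ext _ (diff_plus (hf i) IHs)) => u v.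
by rewrite big_cons.
Qed.

Lemma squeeze_continuity_2d f B x y : (forall u v, Rabs (f u v - f x y) <= B u v) ->
  B x y = 0 -> continuity_2d_pt B x y -> continuity_2d_pt f x y.
Proof.
move=> fB B0 cB eps; apply: (locally_2d_impl _ _ _ _ _ (cB eps)); apply: locally_2d_forall => u v.
by rewrite B0 Rminus_0_r => h; have := fB u v; have := Rle_abs (B u v); lra.
Qed.

(** * Linear contractive systems depending on parameters *)

Section Implicit.
Context (I : nat).
Implicit Types (i j : 'I_I).
Context (L : 'I_I -> R).
Hypotheses (L0 : forall j, 0 <= L j) (L1 : ksum L < 1).

(** In matrix form, (Id + K diag(a)) x = r. *)
Definition lin_sol (r a x : 'I_I -> R) : Prop :=
  forall i, x i = r i - rsum (fun j => K i j * (a j * x j)).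

Lemma lin_lip a : (forall j, Rabs (a j) <= L j) ->
  forall j x y, Rabs (a j * x - a j * y) <= L j * Rabs (x - y).
Proof.
move=> aL j x y; rewrite -Rmult_minus_distr_l Rabs_mult.
by apply: Rmult_le_compat_r => //; apply: Rabs_pos.
Qed.

Lemma lin_exists r a : (forall j, Rabs (a j) <= L j) -> exists x, lin_sol r a x.
Proof. by move=> aL; apply: (fixpoint_exists (G := fun j x => a j * x) r L0 L1 (lin_lip aL)). Qed.

Lemma lin_unique r a x x' : (forall j, Rabs (a j) <= L j) ->
  lin_sol r a x -> lin_sol r a x' -> forall i, x i = x' i.
Proof. by move=> aL; apply: (fixpoint_unique (G := fun j x => a j * x) L0 L1 (lin_lip aL)). Qed.

(** The columns of the inverse matrix are the solutions for unit right-hand sides; linearity and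
    uniqueness do the rest. A solution thus becomes a finite combination of right-hand sides with
    coefficients depending only on [a]. *)
Lemma resolvent a : (forall j, Rabs (a j) <= L j) ->
  exists N : 'I_I -> 'I_I -> R, forall r x, lin_sol r a x -> forall i, x i = rsum (fun m => N i m * r m).
Proof.
move=> aL.
have [N hN] := fchoice (fun m => lin_exists (fun i => if i == m then 1 else 0) aL).
exists (fun i m => N m i) => r x hx; apply: (lin_unique aL hx) => i.
rewrite (rsum_ext (g := fun m => r m * (if i == m then 1 else 0)
  - rsum (fun j => K i j * (a j * (N m j * r m))))); last first.
  move=> m; rewrite {1}hN Rmult_minus_distr_r; congr (_ - _); first ring.
  by rewrite Rmult_comm -rsum_scal; apply: rsum_ext => j; ring.
rewrite rsum_minus; congr (_ - _).
  rewrite /rsum (bigD1 i) //= eqxx big1 => [|m mi]; first by rewrite -[LHS]/(r i * 1 + 0); ring.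
  by rewrite eq_sym (negbTE mi) Rmult_0_r.
rewrite /rsum exchange_big; apply: eq_bigr => j _ /=.
by rewrite -[RHS]/(K i j * (a j * rsum (fun m => N m j * r m))) -!rsum_scal.
Qed.

Lemma lin_cont (r a x : 'I_I -> R -> R -> R) u t :
  (forall j u t, Rabs (a j u t) <= L j) ->
  (forall u t, lin_sol (fun i => r i u t) (fun i => a i u t) (fun i => x i u t)) ->
  (forall i, continuity_2d_pt (r i) u t) -> (forall i, continuity_2d_pt (a i) u t) ->
  forall i, continuity_2d_pt (x i) u t.
Proof.
move=> aL hx rc ac i.
(* The difference of the solutions at (u', t') and (u, t) solves the system with coefficients a(u',
   t') and right-hand side r', in which x occurs only at the base point; hence r' tends to 0. *)
pose r' i u' t' := r i u' t' - r i u t - rsum (fun j => K i j * ((a j u' t' - a j u t) * x j u t)).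
have r'0 m : r' m u t = 0.
  by rewrite /r' rsum0 => [|j]; [ring|rewrite Rminus_diag; ring].
apply: (squeeze_continuity_2d (B := fun u' t' => rsum (fun m => Rabs (r' m u' t')) * / (1 - ksum L))).
- move=> u' t'; apply: (contraction (e := fun i => x i u' t' - x i u t) (r := fun m => r' m u' t')
    (g := fun j => a j u' t' * (x j u' t' - x j u t)) L0 L1) => [m|j|m].
  + rewrite {1}hx [X in _ - X = _]hx /r' -[RHS]/(_ + - _) -Ropp_minus_distr.
    rewrite (rsum_ext (f := fun j => K m j * ((a j u' t' - a j u t) * x j u t))
      (g := fun j => K m j * (a j u' t' * x j u t - a j u t * x j u t))); last by move=> j; ring.
    rewrite (rsum_ext (f := fun j => K m j * (a j u' t' * (x j u' t' - x j u t)))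
      (g := fun j => K m j * (a j u' t' * x j u' t' - a j u' t' * x j u t))); last by move=> j; ring.
    rewrite (Ksum_minus m (fun j => a j u' t' * x j u t) (fun j => a j u t * x j u t)).
    rewrite (Ksum_minus m (fun j => a j u' t' * x j u' t') (fun j => a j u' t' * x j u t)).
    ring.
  + by rewrite Rabs_mult; apply: Rmult_le_compat_r => //; apply: Rabs_pos.
  + by apply: (rsum_term_le (f := fun m => Rabs (r' m u' t'))) => j; apply: Rabs_pos.
- rewrite rsum0 => [|m]; first ring.
  by rewrite r'0 Rabs_R0.
apply: continuity_2d_pt_mult; last exact: continuity_2d_pt_const.
apply: rsum_continuity_2d => m.
apply: (continuity_1d_2d_pt_comp Rabs); first exact: Rcontinuity_abs.
apply: continuity_2d_pt_minus; first by apply: continuity_2d_pt_minus => //; apply: continuity_2d_pt_const.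
apply: rsum_continuity_2d => j.
apply: continuity_2d_pt_mult; first exact: continuity_2d_pt_const.
apply: continuity_2d_pt_mult; last exact: continuity_2d_pt_const.
by apply: continuity_2d_pt_minus => //; apply: continuity_2d_pt_const.
Qed.

(** Replace g_j by al_j y_j plus a remainder, with al frozen at the base point. Then y solves a
    constant-coefficient system whose right-hand side S is differentiable by hypothesis, and the
    resolvent writes y as a linear combination of the S_m. Differentiability of y is thus an
    output. *)
Lemma implicit_diff (A B C al be ga du dt : 'I_I -> R) (y g : 'I_I -> R -> R -> R) u t :
  (forall i u t, y i u t = A i * u + B i * t + C i - rsum (fun j => K i j * g j u t)) ->
  (forall j, Rabs (al j) <= L j) ->
  (forall j, differentiable_pt_lim (fun u t => g j u t - al j * y j u t) u t (be j) (ga j)) ->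
  lin_sol (fun i => A i - rsum (fun j => K i j * be j)) al du ->
  lin_sol (fun i => B i - rsum (fun j => K i j * ga j)) al dt ->
  forall i, differentiable_pt_lim (y i) u t (du i) (dt i).
Proof.
move=> hy alL hg hdu hdt i.
have [N hN] := resolvent alL.
pose S i u t := A i * u + B i * t + C i + -1 * rsum (fun j => K i j * (g j u t - al j * y j u t)).
have yE u' t' : rsum (fun m => N i m * S m u' t') = y i u' t'.
  symmetry; apply: (hN (fun m => S m u' t') (fun i => y i u' t')) => m.
  rewrite {1}hy /S (Ksum_minus m (fun j => g j u' t') (fun j => al j * y j u' t')); ring.
apply: (diff_ext yE); rewrite (hN _ _ hdu) (hN _ _ hdt).
apply: (@rsum_diff _ (fun m u t => N i m * S m u t)) => m; apply: diff_scal.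
have := diff_plus (diff_affine (A m) (B m) (C m) u t)
  (diff_scal (-1) (@rsum_diff _ (fun j u t => K m j * (g j u t - al j * y j u t)) u t _ _
     (fun j => diff_scal (K m j) (hg j)))).
by move=> h; refine (diff_eq h _ _); ring.
Qed.

End Implicit.

(** * Effective speeds and existence in part (a) *)

Section Speed.
Context (I : nat).
Implicit Types (i j : 'I_I).
Context (L : 'I_I -> R).
Hypotheses (L0 : forall j, 0 <= L j) (L1 : ksum L < 1).

Lemma lin_one_bounds a w : (forall j, 0 <= a j <= L j) -> lin_sol (fun _ => 1) a w ->
  forall i, 1 - ksum L <= w i <= 1.
Proof.
move=> aL hw i; have := positivity aL L1 (Rlt_le _ _ Rlt_0_1) hw i; lra.
Qed.

Context (a w : 'I_I -> R).
Hypothesis aL : forall j, 0 <= a j <= L j.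
Hypothesis hw : lin_sol (fun _ => 1) a w.

Lemma aLabs j : Rabs (a j) <= L j.
Proof. by have := aL j; move=> ?; rewrite Rabs_pos_eq; lra. Qed.

Lemma dens_denom_lin r : (forall j, r j = a j * w j) -> forall i, dens_denom r i = w i.
Proof.
by move=> ra i; rewrite dens_denomE hw; congr (_ - _); apply: rsum_ext => j; rewrite ra.
Qed.

(* With r_j = a_j w_j one has M(r) = diag(w) + (K_ij r_j)_ij, so M(r) v = c amounts to the
   contractive system (w v) = c - K (a (w v)). *)
Lemma Mmat_mul r (v : 'I_I -> R) i : (forall j, r j = a j * w j) ->
  rsum (fun j => Mmat r i j * v j) = w i * v i + rsum (fun j => K i j * (a j * (w j * v j))).
Proof.
move=> ra.
have diagE : (1 - \sum_(k < I | k != i) (2 * (minn i.+1 k.+1)%:R * r k))%R = w i + K i i * r i.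
  pose q k := K i k * r k.
  set s := (\sum_(k < I | k != i) q k)%R.
  have qE : rsum q = q i + s by rewrite /rsum (bigD1 i).
  rewrite (eq_bigr q); last by move=> k _; rewrite two_natrE.
  rewrite -[LHS]/(1 - s) -(dens_denom_lin ra) dens_denomE -/q qE /q.
  by rewrite -[_ = _]/(@eq R (1 - s) (1 - (K i i * r i + s) + K i i * r i)); ring.
rewrite (rsum_ext (g := fun j => (if i == j then w i * v i else 0) + K i j * (a j * (w j * v j)))).
  rewrite rsum_plus; congr (_ + _).
  rewrite /rsum (bigD1 i) //= eqxx big1 => [|j ji]; last by rewrite eq_sym (negbTE ji).
  exact: Rplus_0_r.
move=> j; rewrite mxE; case: eqP => [<-|_].
  by rewrite diagE ra; ring.
by rewrite two_natrE -/(K i j) -[(_ * _)%R]/(K i j * r j) ra; ring.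
Qed.

(** By [Mmat_mul], w_i v_i and x_i solve the same contractive system. The definition of [veff]
    through [invmx] can be exploited only once M(r) is known to be invertible, so this comes
    first. *)
Lemma veffE r x : (forall j, r j = a j * w j) -> lin_sol (fun i => INR i.+1) a x ->
  forall i, x i = w i * veff r i.
Proof.
move=> ra hx.
have wb := lin_one_bounds aL hw.
(* Transposing converts M v = 0 into a statement on row vectors. For v in the kernel, w v solves the
   homogeneous contractive system, hence vanishes, and w_j > 0. *)
have unit : Mmat r \in unitmx.
  rewrite -unitmx_tr -row_free_unit; apply: inj_row_free => v vM.
  have v0 j : w j * v ord0 j = 0.
    apply: (lin_unique (r := fun _ => 0) (x := fun j => w j * v ord0 j) (x' := fun _ => 0) L0 L1 aLabs) => i.
      have := congr1 (fun A : 'rV_I => A ord0 i) vM; rewrite !mxE => h.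
      suff : rsum (fun j => Mmat r i j * v ord0 j) = 0 by rewrite Mmat_mul // => ?; lra.
      rewrite -[RHS]h; apply: rsum_ext => k; rewrite [in RHS]mxE.
      by rewrite -[RHS]/(v ord0 k * Mmat r i k) Rmult_comm.
    by rewrite rsum0 => [|k]; ring.
  apply/rowP => j; rewrite mxE; have := v0 j; have := wb j => ? /Rmult_integral [] //.
  by lra.
apply: (lin_unique (x' := fun i => w i * veff r i) L0 L1 aLabs hx) => i.
have := congr1 (fun A : 'cV_I => A i ord0) (mulKVmx unit (\col_(k < I) (k.+1)%:R)%R).
rewrite !mxE -INRE => h.
suff : rsum (fun j => Mmat r i j * veff r j) = INR i.+1 by rewrite Mmat_mul // => ?; lra.
by rewrite -[RHS]h.
Qed.

End Speed.

Lemma diff_line f x y a b : differentiable_pt_lim f x y a b ->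
  derivable_pt_lim (fun z => f z y) x a.
Proof.
move=> hf.
have := derivable_pt_lim_comp_2d f id (fun _ => y) x a b 1 0 hf
  (derivable_pt_lim_id x) (derivable_pt_lim_const y x).
by rewrite Rmult_1_r Rmult_0_r Rplus_0_r.
Qed.

Lemma cont_line f x y : continuity_2d_pt f x y -> continuity_pt (fun z => f z y) x.
Proof.
move=> hf eps e0; have [[d d0] hd] := hf (mkposreal _ e0).
exists d; split=> // z [_ zx]; apply: hd => //; rewrite Rminus_diag Rabs_R0 //.
Qed.

Lemma derivs_Q_diff f g Du Dt : (forall u t, 0 <= u -> 0 <= t -> f u t = g u t) ->
  (forall u t, 0 <= u -> 0 <= t -> differentiable_pt_lim g u t (Du u t) (Dt u t)) ->
  derivs_Q f Du Dt.
Proof.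
move=> fg hg u t u0 t0 eps e0; have [[d d0] hd] := hg u t u0 t0 (mkposreal _ e0).
exists d; split=> // h k uh tk hd' kd; rewrite !fg //.
have := hd (u + h) (t + k); rewrite /= !Rplus_minus_l => /(_ hd' kd).
rewrite (_ : _ - _ - (_ + _) = g (u + h) (t + k) - g u t - Du u t * h - Dt u t * k); last ring.
move=> h1; apply: Rle_trans h1 _; apply: Rmult_le_compat_l; first lra.
by have := Rabs_pos h; have := Rabs_pos k; move=> *; apply: Rmax_lub; lra.
Qed.

Lemma cont_Q_2d f : (forall u t, 0 <= u -> 0 <= t -> continuity_2d_pt f u t) -> cont_Q f.
Proof.
move=> hf u t u0 t0 eps e0; have [[d d0] hd] := hf u t u0 t0 (mkposreal _ e0).
by exists d; split=> // u' t' _ _; apply: hd.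
Qed.

(** * The flow Y and its first derivatives *)

Section Flow.
Context (I : nat).
Implicit Types (i j : 'I_I).
Context (L : 'I_I -> R) (F f : 'I_I -> R -> R) (Y : 'I_I -> R -> R -> R).
Hypothesis HF : slope_sys L F.
Hypothesis Ff : forall i x, derivable_pt_lim (F i) x (f i x).
Hypothesis fcont : forall i, continuity (f i).
Hypothesis HY : is_Y F Y.

Let L0 : forall j, 0 <= L j. Proof. by case: HF. Qed.
Let L1 : ksum L < 1. Proof. by case: HF. Qed.

Lemma F_lim_bounds i x : 0 <= f i x <= L i.
Proof.
apply: (lim_bounds _ (Ff i x)) => y z yz.
by case: HF => _ _ Fs _; have := Fs i y z yz; lra.
Qed.

Let fabs u t j : Rabs (f j (Y j u t)) <= L j.
Proof. by have := F_lim_bounds j (Y j u t) => ?; rewrite Rabs_pos_eq; lra. Qed.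

(** The right-hand side u - j t moves by at most |u' - u| + j |t' - t| with j <= I, which explains 1
    + I; the denominator comes from [fixpoint_dist]. *)
Lemma Y_lip i u t u' t' :
  Rabs (Y i u' t' - Y i u t) <= (1 + INR I) / (1 - ksum L) * Rmax (Rabs (u' - u)) (Rabs (t' - t)).
Proof.
set m := Rmax _ _.
have := @fixpoint_dist I L F (fun i => u' - INR i.+1 * t') (fun i => u - INR i.+1 * t)
  (fun i => Y i u' t') (fun i => Y i u t) ((1 + INR I) * m) L0 L1 (sys_lip HF)
  (fun i => HY i u' t') (fun i => HY i u t) _ i.
move=> h; apply: Rle_trans (h _) _; last by right; field; lra.
move=> j; rewrite (_ : _ - _ = (u' - u) + - INR j.+1 * (t' - t)); last ring.
apply: Rle_trans (Rabs_triang _ _) _; rewrite Rabs_mult Rabs_Ropp (Rabs_pos_eq (INR j.+1)); last exact: pos_INR.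
have hu : Rabs (u' - u) <= m by apply: Rmax_l.
have ht : Rabs (t' - t) <= m by apply: Rmax_r.
have jI : INR j.+1 <= INR I by apply/le_INR/leP; apply: ltn_ord.
by have := pos_INR j.+1; have := Rabs_pos (t' - t); nra.
Qed.

(** The remainder is o(|Y_j(u', t') - Y_j(u, t)|) by differentiability of F_j, hence o of the
    displacement by [Y_lip]. It is the input of [implicit_diff] with be = ga = 0. *)
Lemma F_sub_diff j u t :
  differentiable_pt_lim (fun u' t' => F j (Y j u' t') - f j (Y j u t) * Y j u' t') u t 0 0.
Proof.
move=> eps; set C := (1 + INR I) / (1 - ksum L).
have C0 : 0 < C by apply: Rdiv_lt_0_compat; [have := pos_INR I; lra|lra].
have e0 : 0 < eps / C by apply: Rdiv_lt_0_compat => //; apply: cond_pos.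
have [[d d0] hd] := Ff j (Y j u t) e0.
have dC : 0 < d / C by apply: Rdiv_lt_0_compat.
exists (mkposreal _ dC) => u' t' /= hu ht.
set m := Rmax _ _.
have Yl : Rabs (Y j u' t' - Y j u t) <= C * m by apply: Y_lip.
have mdC : m < d / C by apply: Rmax_lub_lt.
have md : C * m < d.
  by have := Rmult_lt_compat_l C _ _ C0 mdC; rewrite (_ : C * (d / C) = d) //; field; lra.
set k := Y j u' t' - Y j u t in Yl.
rewrite (_ : _ - _ = F j (Y j u t + k) - F j (Y j u t) - f j (Y j u t) * k); last first.
  by rewrite /k Rplus_minus; ring.
have key : Rabs (F j (Y j u t + k) - F j (Y j u t) - f j (Y j u t) * k) <= eps / C * Rabs k.
  have [->|k0] := Req_dec k 0.
    by rewrite Rplus_0_r Rabs_R0 !Rmult_0_r Rminus_diag Rminus_0_r Rabs_R0; lra.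
  have kd : Rabs k < d by lra.
  have /= := hd k k0 kd.
  rewrite (_ : _ - _ - _ = ((F j (Y j u t + k) - F j (Y j u t)) / k - f j (Y j u t)) * k).
    by rewrite Rabs_mult => ?; apply: Rmult_le_compat_r; [apply: Rabs_pos|lra].
  by field.
apply: Rle_trans key _; apply: Rle_trans (Rmult_le_compat_l _ _ _ (Rlt_le _ _ e0) Yl) _.
by right; field; lra.
Qed.

Lemma Y_cont i u t : continuity_2d_pt (Y i) u t.
Proof.
set C := (1 + INR I) / (1 - ksum L).
have C0 : 0 < C by apply: Rdiv_lt_0_compat; [have := pos_INR I; lra|lra].
move=> eps; have dC : 0 < eps / C by apply: Rdiv_lt_0_compat => //; apply: cond_pos.
exists (mkposreal _ dC) => u' t' /= hu ht; apply: Rle_lt_trans (Y_lip _ _ _ _ _) _.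
have mdC : Rmax (Rabs (u' - u)) (Rabs (t' - t)) < eps / C by apply: Rmax_lub_lt.
have := Rmult_lt_compat_l C _ _ C0 mdC; rewrite -/C (_ : C * (eps / C) = eps) //.
by field; lra.
Qed.

Lemma fY_cont i u t : continuity_2d_pt (fun u t => f i (Y i u t)) u t.
Proof. by apply: continuity_1d_2d_pt_comp (Y_cont i u t); apply: fcont. Qed.

Context (w x : 'I_I -> R -> R -> R).
Hypothesis hw : forall u t, lin_sol (fun _ => 1) (fun j => f j (Y j u t)) (fun j => w j u t).
Hypothesis hx : forall u t, lin_sol (fun i => INR i.+1) (fun j => f j (Y j u t)) (fun j => x j u t).

Lemma Y_diff i u t : differentiable_pt_lim (Y i) u t (w i u t) (- x i u t).
Proof.
apply: (implicit_diff (A := fun _ => 1) (B := fun i => - INR i.+1) (C := fun _ => 0)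
  (al := fun j => f j (Y j u t)) (be := fun _ => 0) (ga := fun _ => 0)
  (du := fun i => w i u t) (dt := fun i => - x i u t)
  (g := fun j u t => F j (Y j u t)) L0 L1 _ (fabs u t)) => [k u' t'|j|k|k].
- by rewrite HY; ring.
- exact: F_sub_diff.
- rewrite (rsum0 (f := fun j => K k j * 0)) => [|j]; last ring.
  by rewrite Rminus_0_r; apply: hw.
- rewrite (rsum0 (f := fun j => K k j * 0)) => [|j]; last ring.
  rewrite [LHS](_ : _ = - (INR k.+1 - rsum (fun j => K k j * (f j (Y j u t) * x j u t)))); last by rewrite -hx.
  rewrite (rsum_ext (g := fun j => - (K k j * (f j (Y j u t) * x j u t))) (f := fun j => K k j * (_ * - _))); last by move=> j; ring.
  by rewrite rsum_opp; ring.
Qed.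

Lemma w_cont i u t : continuity_2d_pt (w i) u t.
Proof.
apply: (lin_cont (r := fun _ _ _ => 1) (a := fun j u t => f j (Y j u t)) L0 L1) => [j u' t'|//|j|j].
- exact: fabs.
- exact: continuity_2d_pt_const.
- exact: fY_cont.
Qed.

Lemma x_cont i u t : continuity_2d_pt (x i) u t.
Proof.
apply: (lin_cont (r := fun i _ _ => INR i.+1) (a := fun j u t => f j (Y j u t)) L0 L1) => [j u' t'|//|j|j].
- exact: fabs.
- exact: continuity_2d_pt_const.
- exact: fY_cont.
Qed.

Lemma w_bounds i u t : 1 - ksum L <= w i u t <= 1.
Proof. by apply: (lin_one_bounds L1 _ (hw u t)) => j; apply: F_lim_bounds. Qed.

Lemma FY_diff i u t : differentiable_pt_lim (fun u t => F i (Y i u t)) u t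
  (f i (Y i u t) * w i u t) (- (f i (Y i u t) * x i u t)).
Proof. by apply: diff_eq (diff_comp (Ff i _) (Y_diff i u t)) _ _; ring. Qed.

Lemma Y_lt0 i u t : 0 <= t -> u < 0 -> Y i u t < 0.
Proof.
move=> t0 u0; have := sol_lt0 (slope_sys_shift t0 HF) (is_Y_sol t HY) i u0.
by have := pos_INR i.+1; nra.
Qed.

Lemma F_ge0 i z : 0 <= F i z.
Proof.
case: HF => _ _ Fs F0; have [z0|z0] := Rle_lt_dec 0 z; last by rewrite F0; lra.
by have := Fs i 0 z z0; rewrite (F0 i 0); lra.
Qed.

Context (psi0 : 'I_I -> R -> R).
Hypothesis FPhi : forall i u, F i (Phi psi0 i u) = ext0 (psi0 i) u.

Let psiE u t i : 0 <= t -> 0 <= u -> psi_sol psi0 i u t = F i (Y i u t).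
Proof. by move=> t0 u0; apply: (psi_solE HF FPhi HY t0).2. Qed.

Lemma flow_C1 i : C1_Q (psi_sol psi0 i)
  (fun u t => f i (Y i u t) * w i u t) (fun u t => - (f i (Y i u t) * x i u t)).
Proof.
split; [|split].
- apply: (derivs_Q_diff (g := fun u t => F i (Y i u t))) => u t u0 t0; first exact: psiE.
  exact: FY_diff.
- by apply: cont_Q_2d => u t _ _; apply: continuity_2d_pt_mult; [apply: fY_cont|apply: w_cont].
- apply: cont_Q_2d => u t _ _; apply: continuity_2d_pt_opp.
  by apply: continuity_2d_pt_mult; [apply: fY_cont|apply: x_cont].
Qed.

Lemma flow_ge0 i : nonneg_Q (psi_sol psi0 i).
Proof. by move=> u t u0 t0; rewrite psiE //; apply: F_ge0. Qed.

Lemma flow_init i u : 0 <= u -> psi_sol psi0 i u 0 = psi0 i u.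
Proof.
move=> u0; rewrite psiE //; last lra.
rewrite -(ext0_ge0 (psi0 i) u0) -FPhi; congr F.
apply: (fixpoint_unique (G := F) (r := fun _ => u) (e := fun i => Y i u 0)
  (e' := fun i => Phi psi0 i u) L0 L1 (sys_lip HF)) => k.
  by rewrite HY; ring.
exact: (Phi_sol FPhi).
Qed.

Lemma flow_speed i u t :
  x i u t = w i u t * veff (fun j => f j (Y j u t) * w j u t) i.
Proof.
apply: (veffE (a := fun j => f j (Y j u t)) (x := fun j => x j u t) (w := fun j => w j u t)
  L0 L1 _ (hw u t)) => // j; exact: F_lim_bounds.
Qed.

Lemma flow_solves : solves_a psi0 (psi_sol psi0).
Proof.
split; [exact: flow_ge0|split; [|split; [exact: flow_init|]]].
  move=> t t0; split; first exact: (psi_solE HF FPhi HY t0).1.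
  move=> i; split; first by move=> u u0; apply: flow_ge0.
  exists (fun u => f i (Y i u t) * w i u t).
  (* For u < 0 the label Y_i is negative and F_i vanishes there, so F_i(Y_i) already is the zero
     extension and its two-sided derivative can be used across 0. *)
  have E u : F i (Y i u t) = ext0 (fun u => psi_sol psi0 i u t) u.
    have [u0|u0] := Rle_lt_dec 0 u; first by rewrite ext0_ge0 // psiE.
    rewrite ext0_lt0 //; case: HF => _ _ _ -> //.
    exact/Rlt_le/Y_lt0.
  split=> [u|u].
    apply/is_derive_Reals; apply: (is_derive_ext _ _ _ _ E); apply/is_derive_Reals.
    exact: (diff_line (FY_diff i u t)).
  apply: (@cont_line (fun u t => f i (Y i u t) * w i u t)).
  by apply: continuity_2d_pt_mult; [apply: fY_cont|apply: w_cont].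
exists (fun i u t => f i (Y i u t) * w i u t), (fun i u t => - (f i (Y i u t) * x i u t)).
split=> [i|i u t u0 t0]; first exact: flow_C1.
by rewrite flow_speed; ring.
Qed.

End Flow.

Lemma lin_exists_Q (I : nat) (L : 'I_I -> R) (f : 'I_I -> R -> R) (Y : 'I_I -> R -> R -> R)
  (r : 'I_I -> R -> R -> R) :
  (forall j, 0 <= L j) -> ksum L < 1 -> (forall j x, 0 <= f j x <= L j) ->
  exists w : 'I_I -> R -> R -> R,
    forall u t, lin_sol (fun i => r i u t) (fun j => f j (Y j u t)) (fun j => w j u t).
Proof.
move=> L0 L1 fL.
have [w hw] := fchoice (fun p : R * R => lin_exists L0 L1 (fun i => r i p.1 p.2)
  (fun j => aLabs (fun j => fL j (Y j p.1 p.2)) j)).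
by exists (fun i u t => w (u, t) i) => u t; apply: (hw (u, t)).
Qed.

Lemma InD1_sys (I : nat) (psi : 'I_I -> R -> R) : InD1 psi ->
  exists L F f, [/\ slope_sys L F, forall i u, F i (Phi psi i u) = ext0 (psi i) u,
    forall i x, derivable_pt_lim (F i) x (f i x) & forall i, continuity (f i)].
Proof.
case=> psiD psi1; have [L [F [HF FPhi]]] := InD_sys psiD.
have [p hp] := fchoice (fun i => (psi1 i).2).
have [f [Ff fc _]] := sys_C1 HF FPhi (fun i => (hp i).1) (fun i => (hp i).2).
by exists L, F, f.
Qed.

(** * Uniqueness in part (a) *)

Definition pder (f : R -> R) (u l : R) : Prop :=
  forall eps, 0 < eps -> exists delta, 0 < delta /\
    forall h, 0 <= u + h -> Rabs h < delta -> Rabs (f (u + h) - f u - l * h) <= eps * Rabs h.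

Lemma lim_pder f u l : 0 <= u -> derivable_pt_lim (ext0 f) u l -> pder f u l.
Proof.
move=> u0 hf eps e0; have [[d d0] hd] := hf eps e0.
exists d; split=> // h uh hd'.
have [->|h0] := Req_dec h 0.
  by rewrite Rplus_0_r Rminus_diag Rmult_0_r Rminus_0_r Rabs_R0; lra.
have /= := hd h h0 hd'; rewrite !ext0_ge0 // => hh.
rewrite (_ : _ - _ - _ = ((f (u + h) - f u) / h - l) * h); last by field.
by rewrite Rabs_mult; apply: Rmult_le_compat_r; [apply: Rabs_pos|lra].
Qed.

(** A positive increment h is admissible even at u = 0, and two errors of a quarter of |l - l'| h
    cannot add up to |l - l'| h. *)
Lemma pder_unique f u l l' : 0 <= u -> pder f u l -> pder f u l' -> l = l'.
Proof.
move=> u0 h1 h2; apply: Rminus_diag_uniq; apply: NNPP => ne.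
have e0 := Rabs_pos_lt _ ne; have e4 : 0 < Rabs (l - l') / 4 by lra.
have [d [d0 hd]] := h1 _ e4; have [d' [d'0 hd']] := h2 _ e4.
have m := Rmin_glb_lt _ _ _ d0 d'0; have m1 := Rmin_l d d'; have m2 := Rmin_r d d'.
set h := Rmin d d' / 2.
have [hp hdd hdd'] : [/\ 0 < h, h < d & h < d'] by rewrite /h; split; lra.
have := hd h ltac:(lra); rewrite Rabs_pos_eq; last lra.
move=> /(_ hdd) A; have := hd' h ltac:(lra); rewrite Rabs_pos_eq; last lra.
move=> /(_ hdd') B.
have := Rabs_triang (f (u + h) - f u - l' * h) (- (f (u + h) - f u - l * h)).
rewrite Rabs_Ropp (_ : _ + - _ = (l - l') * h); last ring.
by rewrite Rabs_mult (Rabs_pos_eq h); nra.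
Qed.

Lemma derivs_Q_pder f Du Dt u t : derivs_Q f Du Dt -> 0 <= u -> 0 <= t ->
  pder (fun u => f u t) u (Du u t).
Proof.
move=> hf u0 t0 eps e0; have [d [d0 hd]] := hf u t u0 t0 eps e0.
exists d; split=> // h uh hh.
have := hd h 0 uh; rewrite Rplus_0_r Rabs_R0 Rmult_0_r Rminus_0_r Rplus_0_r.
exact.
Qed.

Lemma derivs_Q_lin f g Du Dt Du' Dt' c : derivs_Q f Du Dt -> derivs_Q g Du' Dt' ->
  derivs_Q (fun u t => f u t + c * g u t) (fun u t => Du u t + c * Du' u t) (fun u t => Dt u t + c * Dt' u t).
Proof.
move=> hf hg u t u0 t0 eps e0.
have c0 : 0 < 2 * (1 + Rabs c) by have := Rabs_pos c; lra.
have e2 : 0 < eps / 2 by lra.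
have e3 : 0 < eps / (2 * (1 + Rabs c)) by apply: Rdiv_lt_0_compat.
have [d [d0 hd]] := hf u t u0 t0 _ e2; have [d' [d'0 hd']] := hg u t u0 t0 _ e3.
exists (Rmin d d'); split; first exact: Rmin_glb_lt.
move=> h k uh tk /Rlt_le_trans hh /Rlt_le_trans kk.
have A := hd h k uh tk (hh _ (Rmin_l _ _)) (kk _ (Rmin_l _ _)).
have B := hd' h k uh tk (hh _ (Rmin_r _ _)) (kk _ (Rmin_r _ _)).
set X := f _ _ - _ - _ - _ in A; set Z := g _ _ - _ - _ - _ in B.
rewrite (_ : _ - _ - _ - _ = X + c * Z); last by rewrite /X /Z; ring.
apply: Rle_trans (Rabs_triang _ _) _; rewrite Rabs_mult.
set s := Rabs h + Rabs k in A B *.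
have s0 : 0 <= s by rewrite /s; have := Rabs_pos h; have := Rabs_pos k; lra.
have -> : eps * s = eps / 2 * s + (1 + Rabs c) * (eps / (2 * (1 + Rabs c)) * s).
  by field; have := Rabs_pos c; lra.
apply: Rplus_le_compat => //.
by apply: Rmult_le_compat => //; try exact: Rabs_pos; lra.
Qed.

Lemma derivs_Q_ext f g Du Dt Du' Dt' : derivs_Q f Du Dt ->
  (forall u t, f u t = g u t) -> (forall u t, 0 <= u -> 0 <= t -> Du u t = Du' u t) ->
  (forall u t, 0 <= u -> 0 <= t -> Dt u t = Dt' u t) -> derivs_Q g Du' Dt'.
Proof.
move=> hf fg hu ht u t u0 t0 eps e0; have [d [d0 hd]] := hf u t u0 t0 eps e0.
by exists d; split=> // h k uh tk hh kk; rewrite -!fg -hu // -ht //; apply: hd.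
Qed.

Lemma rsum_derivs_Q (I : nat) (c : 'I_I -> R) (f Du Dt : 'I_I -> R -> R -> R) :
  (forall i, derivs_Q (f i) (Du i) (Dt i)) ->
  derivs_Q (fun u t => rsum (fun i => c i * f i u t)) (fun u t => rsum (fun i => c i * Du i u t))
    (fun u t => rsum (fun i => c i * Dt i u t)).
Proof.
move=> hf; rewrite /rsum; elim: (index_enum _) => [|i s IHs].
  move=> u t _ _ eps e0; exists 1; split=> [|h k _ _ _ _]; first lra.
  rewrite !big_nil (_ : _ - _ - _ - _ = 0) ?Rabs_R0; last by rewrite -[0%R]/0; ring.
  by apply: Rmult_le_pos; [lra|have := Rabs_pos h; have := Rabs_pos k; lra].
by apply: (derivs_Q_ext (derivs_Q_lin (c i) IHs (hf i))) => [u t|u t _ _|u t _ _];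
  rewrite big_cons Rplus_comm.
Qed.

Lemma phi_derivs_Q (I : nat) (Psi Du Dt : 'I_I -> R -> R -> R) i :
  (forall i, derivs_Q (Psi i) (Du i) (Dt i)) ->
  derivs_Q (fun u t => phi (fun i u => Psi i u t) i u)
    (fun u t => 1 - rsum (fun j => K i j * Du j u t)) (fun u t => - rsum (fun j => K i j * Dt j u t)).
Proof.
move=> hP.
have id_d : derivs_Q (fun u _ => u) (fun _ _ => 1) (fun _ _ => 0).
  move=> u t _ _ eps e0; exists 1; split=> [|h k _ _ _ _]; first lra.
  rewrite (_ : _ - _ - _ - _ = 0) ?Rabs_R0; last ring.
  by apply: Rmult_le_pos; [lra|have := Rabs_pos h; have := Rabs_pos k; lra].
apply: (derivs_Q_ext (derivs_Q_lin (-1) id_d (rsum_derivs_Q (K i) hP))) => [u t|u t _ _|u t _ _].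
- by rewrite phiE; ring.
- by ring.
- by ring.
Qed.

(** Continuing H to the left of t0 by its value at t0 gives a function with two-sided derivative 0
    everywhere. *)
Lemma null_der_const H t0 :
  (forall t, t0 <= t -> forall eps, 0 < eps -> exists delta, 0 < delta /\
    forall k, t0 <= t + k -> Rabs k < delta -> Rabs (H (t + k) - H t) <= eps * Rabs k) ->
  forall t, t0 <= t -> H t = H t0.
Proof.
move=> hH t t0t.
pose G s := H (Rmax s t0).
have G' s : is_derive G s 0.
  apply/is_derive_Reals => eps e0; have [ts|st] := Rle_lt_dec t0 s.
    have e2 : 0 < eps / 2 by lra.
    have [d [d0 hd]] := hH s ts _ e2; exists (mkposreal _ d0) => h h0 /= hh.
    pose k := Rmax (s + h) t0 - s.
    have kh : Rabs k <= Rabs h.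
      rewrite /k /Rmax; case: Rle_dec => c; last by right; congr Rabs; ring.
      by rewrite Rabs_left1 ?[Rabs h]Rabs_left1; lra.
    rewrite /G (Rmax_left s) // Rminus_0_r.
    have := hd k; rewrite {1 3}/k !Rplus_minus => /(_ (Rmax_r _ _) (Rle_lt_trans _ _ _ kh hh)) A.
    have hp := Rabs_pos_lt _ h0.
    rewrite Rabs_div //; apply/Rlt_div_l => //.
    by apply: Rle_lt_trans A _; nra.
  have d0 : 0 < t0 - s by lra.
  exists (mkposreal _ d0) => h h0 /= hh; have := Rle_abs h => hh'.
  rewrite /G !Rmax_right; try lra.
  by rewrite Rminus_diag /Rdiv Rmult_0_l Rminus_0_r Rabs_R0.
have [lt|->] : t0 < t \/ t0 = t by lra.
  have := @eq_is_derive _ G t0 t (fun s _ => G' s) lt.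
  by rewrite /G !Rmax_left //; lra.
by [].
Qed.

(* psi is transported by the level sets {phi = s + c t}, parametrized by u = U(t):
   differentiating phi(U(t), t) = s + c t gives U' = v, hence d/dt psi(U(t), t) = 0.
   The slope of phi is not bounded below uniformly in t, so the bound |U(t + k) - U(t)| <= C |k|
   is read off from the monotonicity of phi at time t + k. *)
Lemma level_const (ph ps w v r : R -> R -> R) (U : R -> R) (c s t0 : R) :
  derivs_Q ph w (fun u t => c - w u t * v u t) ->
  derivs_Q ps r (fun u t => - (v u t * r u t)) ->
  (forall u t, 0 <= u -> 0 <= t -> 0 < w u t) ->
  (forall u u' t, 0 <= u -> 0 <= t -> u < u' -> ph u t < ph u' t) ->
  0 <= t0 -> (forall t, t0 <= t -> 0 <= U t /\ ph (U t) t = s + c * t) ->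
  forall t, t0 <= t -> ps (U t) t = ps (U t0) t0.
Proof.
move=> dph dps w0 mono t00 hU; apply: (@null_der_const (fun t => ps (U t) t)) => t tt0 eps e0.
have [u0 phu] := hU t tt0; set u := U t in u0 phu *.
have t0' : 0 <= t by lra.
have wp := w0 u t u0 t0'; set W := w u t in wp; set V := v u t; set r0 := r u t.
(* C exceeds the speed |V| by 1, a margin of W |k| in phi. [eta1] keeps the error of phi at u + C
   |k| and u - C |k| to half that margin; [eta2] then makes h - V k small against k, and [eta3]
   controls the increment of psi. The factors C + 1 absorb |h| + |k|. *)
pose C := Rabs V + 1; have C0 : 0 < C + 1 by rewrite /C; have := Rabs_pos V; lra.
have r1 : 0 < Rabs r0 + 1 by have := Rabs_pos r0; lra.
pose eta1 := W / (2 * (C + 1)).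
pose eta2 := eps * W / (2 * (C + 1) * (Rabs r0 + 1)).
pose eta3 := eps / (2 * (C + 1)).
have eta10 : 0 < eta1 by apply: Rdiv_lt_0_compat; nra.
have eta20 : 0 < eta2 by apply: Rdiv_lt_0_compat; [nra|apply: Rmult_lt_0_compat; lra].
have eta30 : 0 < eta3 by apply: Rdiv_lt_0_compat; lra.
have [d1 [d10 hd1]] := dph u t u0 t0' _ eta10.
have [d2 [d20 hd2]] := dph u t u0 t0' _ eta20.
have [d3 [d30 hd3]] := dps u t u0 t0' _ eta30.
pose d := Rmin d1 (Rmin d2 d3).
have dd0 : 0 < d by do 2 (apply: Rmin_glb_lt => //).
have [dd1 dd2 dd3] : [/\ d <= d1, d <= d2 & d <= d3].
  split; first exact: Rmin_l.
    by apply: Rle_trans (Rmin_r _ _) (Rmin_l _ _).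
  by apply: Rle_trans (Rmin_r _ _) (Rmin_r _ _).
exists (d / (C + 1)); split=> [|k tk kd]; first exact: Rdiv_lt_0_compat.
have [->|kne] := Req_dec k 0.
  by rewrite Rplus_0_r Rminus_diag Rabs_R0; lra.
have kp := Rabs_pos_lt _ kne.
have Ck : (C + 1) * Rabs k < d.
  by have := Rmult_lt_compat_l _ _ _ C0 kd; rewrite (_ : (C + 1) * (d / (C + 1)) = d) //; field; lra.
have Ckd : C * Rabs k < d by lra.
have kd' : Rabs k < d by rewrite /C in Ck Ckd; have := Rabs_pos V; nra.
have tk0 : 0 <= t + k by lra.
have [U0 phU] := hU (t + k) tk; set u' := U (t + k) in U0 phU *.
have Vk : Rabs (V * k) <= Rabs V * Rabs k by rewrite Rabs_mult; lra.
have /Rabs_le_between Vk' := Vk.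
have CaR : Rabs (C * Rabs k) = C * Rabs k.
  by rewrite Rabs_pos_eq //; apply: Rmult_le_pos; [rewrite /C; have := Rabs_pos V; lra|lra].
have eta1C : eta1 * (C * Rabs k + Rabs k) = W / 2 * Rabs k by rewrite /eta1; field; lra.
have up : u' < u + C * Rabs k.
  apply: Rnot_le_lt => le.
  have uC : 0 <= u + C * Rabs k by move: CaR; have := Rabs_pos (C * Rabs k); lra.
  have h1 : ph (u + C * Rabs k) (t + k) <= ph u' (t + k).
    by case: le => [lt|->]; [apply/Rlt_le/mono|right].
  have := hd1 (C * Rabs k) k uC tk0; rewrite CaR eta1C => /(_ ltac:(lra) ltac:(lra)) /Rabs_le_between.
  rewrite phu -/V -/W; rewrite phU in h1; rewrite /C in h1 *; nra.
have lo : u - C * Rabs k < u'.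
  (* A lower barrier to the left of 0 is respected automatically, since u' >= 0; this covers curves
     starting on the boundary. *)
  have [neg|uC] := Rlt_le_dec (u - C * Rabs k) 0; first lra.
  apply: Rnot_le_lt => le.
  have h1 : ph u' (t + k) <= ph (u - C * Rabs k) (t + k).
    by case: le => [lt|->]; [apply/Rlt_le/mono|right].
  have := hd1 (- (C * Rabs k)) k uC tk0; rewrite Rabs_Ropp CaR eta1C => /(_ ltac:(lra) ltac:(lra)) /Rabs_le_between.
  rewrite phu -/V -/W -[u + - _]/(u - C * Rabs k); rewrite phU in h1; rewrite /C in h1 *; nra.
pose h := u' - u.
have hC : Rabs h <= C * Rabs k by apply: Rabs_le; rewrite /h; lra.
have uh : u + h = u' by rewrite /h; ring.
have uh0 : 0 <= u + h by rewrite uh.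
have hkC : Rabs h + Rabs k <= (C + 1) * Rabs k by lra.
have := hd2 h k uh0 tk0 ltac:(lra) ltac:(lra); rewrite uh phU phu -/V -/W.
rewrite (_ : _ - _ - _ - _ = - (W * (h - V * k))); last ring.
rewrite Rabs_Ropp Rabs_mult (Rabs_pos_eq W); last lra.
move=> A; have {A} hV : Rabs (h - V * k) <= eps / (2 * (Rabs r0 + 1)) * Rabs k.
  apply: (Rmult_le_reg_l W) => //; apply: Rle_trans A _.
  apply: Rle_trans (Rmult_le_compat_l _ _ _ (Rlt_le _ _ eta20) hkC) _.
  by right; rewrite /eta2; field; lra.
have := hd3 h k uh0 tk0 ltac:(lra) ltac:(lra); rewrite uh -/V -/r0.
set D := ps u' (t + k) - ps u t.
rewrite (_ : D - _ - _ = D - r0 * (h - V * k)); last ring.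
move=> B; have {B} DB : Rabs (D - r0 * (h - V * k)) <= eps / 2 * Rabs k.
  apply: Rle_trans B _; apply: Rle_trans (Rmult_le_compat_l _ _ _ (Rlt_le _ _ eta30) hkC) _.
  by right; rewrite /eta3; field; lra.
have := Rabs_triang (D - r0 * (h - V * k)) (r0 * (h - V * k)).
rewrite (_ : _ + _ = D); last ring.
rewrite Rabs_mult => T.
have : Rabs r0 * Rabs (h - V * k) <= (Rabs r0 + 1) * (eps / (2 * (Rabs r0 + 1)) * Rabs k).
  by apply: Rmult_le_compat => //; try exact: Rabs_pos; lra.
rewrite (_ : _ * (_ / _ * _) = eps / 2 * Rabs k); last by field; lra.
lra.
Qed.

Section UniqueA.
Context (I : nat).
Implicit Types (i j : 'I_I).

(** Differentiating F_i(Phi_i) = psi_i gives r_i = a_i w_i with w_i the derivative of phi_i, which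
    is the setting of [veffE]. The identity obtained is what turns the time derivative of phi_i into
    i - w_i v_i along a solution. *)
Lemma InD1_speed (psi : 'I_I -> R -> R) (r : 'I_I -> R) u : InD1 psi -> 0 <= u ->
  (forall j, pder (psi j) u (r j)) ->
  forall i, 0 < 1 - rsum (fun j => K i j * r j) /\
    (1 - rsum (fun j => K i j * r j)) * veff r i =
      INR i.+1 - rsum (fun j => K i j * (veff r j * r j)).
Proof.
move=> psiD u0 hr.
have [L [F [f [HF FPhi Ff fc]]]] := InD1_sys psiD.
case: psiD => _ psi1; have [p hp] := fchoice (fun i => (psi1 i).2).
have rp j : r j = p j u.
  by apply: (pder_unique u0 (hr j)); apply: lim_pder => //; case: (hp j).
have plim i x : derivable_pt_lim (ext0 (psi i)) x (p i x) by case: (hp i).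
have Phil := Phi_lim plim.
pose a i := f i (Phi psi i u); pose w i := Phi' p i u.
have pa i : p i u = a i * w i.
  apply: (uniqueness_limite (ext0 (psi i)) u) => //.
  apply/is_derive_Reals; apply: (is_derive_ext _ _ _ _ (FPhi i)); apply/is_derive_Reals.
  by apply: (derivable_pt_lim_comp (Phi psi i) (F i)).
have wE i : 1 - rsum (fun j => K i j * r j) = w i.
  by congr (_ - _); apply: rsum_ext => j; rewrite rp.
have aL j : 0 <= a j <= L j by apply: F_lim_bounds HF Ff j _.
case: (HF) => L0 L1 _ _.
have hw : lin_sol (fun _ => 1) a w.
  by move=> i; rewrite /w /Phi'; congr (_ - _); apply: rsum_ext => j; rewrite pa.
have [x hx] := lin_exists L0 L1 (fun i => INR i.+1) (aLabs aL).
have xv := veffE L0 L1 aL hw (fun j => etrans (rp j) (pa j)) hx.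
move=> i; rewrite wE; split; first by have := lin_one_bounds L1 aL hw i; lra.
rewrite -xv hx; congr (_ - _); apply: rsum_ext => j.
by rewrite xv rp pa; ring.
Qed.

Lemma InD1_phi_mono (psi : 'I_I -> R -> R) i u v : InD1 psi -> 0 <= u -> u < v ->
  phi psi i u < phi psi i v.
Proof.
move=> psiD u0 uv; have [L [F [f [HF FPhi _ _]]]] := InD1_sys psiD.
have PhiP x : 0 <= x -> Phi psi i x = phi psi i x.
  by move=> x0; rewrite phiE; congr (_ - _); apply: rsum_ext => j; rewrite ext0_ge0.
rewrite -!PhiP; try lra; have := sol_slope HF (Phi_sol FPhi) i (Rlt_le _ _ uv).
by case: HF => _ L1 _ _; nra.
Qed.

Lemma InD1_phi_surj (psi : 'I_I -> R -> R) i z : InD1 psi -> 0 <= z ->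
  exists u, 0 <= u /\ phi psi i u = z.
Proof.
move=> psiD z0; have [L [F [f [HF FPhi _ _]]]] := InD1_sys psiD.
have [u [u0 uz]] := sol_surj_pos HF (Phi_sol FPhi) i z0.
by exists u; split=> //; rewrite -uz phiE; congr (_ - _); apply: rsum_ext => j; rewrite ext0_ge0.
Qed.

Lemma InD_phi0 (psi : 'I_I -> R -> R) i : InD psi -> phi psi i 0 = 0.
Proof.
case=> psiC _; rewrite phiE rsum0 => [|j]; first ring.
by case: (psiC j) => -> _; ring.
Qed.

Lemma solves_a_unique psi0 Psi : InD1 psi0 -> solves_a psi0 Psi ->
  forall i u t, 0 <= u -> 0 <= t -> Psi i u t = psi_sol psi0 i u t.
Proof.
move=> psiD [_ [PsiD [Psi0 [Du [Dt [C1 pde]]]]]].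
have [L [F [f [HF FPhi Ff fc]]]] := InD1_sys psiD.
case: (HF) => L0 L1 _ F0.
have dPsi j : derivs_Q (Psi j) (Du j) (Dt j) by case: (C1 j).
pose ph i u t := phi (fun i u => Psi i u t) i u.
pose w i u t := 1 - rsum (fun j => K i j * Du j u t).
pose v i u t := veff (fun j => Du j u t) i.
have speed i u t : 0 <= u -> 0 <= t -> 0 < w i u t /\
    w i u t * v i u t = INR i.+1 - rsum (fun j => K i j * (v j u t * Du j u t)).
  move=> u0 t0; apply: (InD1_speed (PsiD t t0) u0) => j.
  exact: (derivs_Q_pder (dPsi j)).
(* The equation yields d_t phi_i = sum_j K_ij v_j d_u psi_j, which [speed] rewrites in the form
   required by [level_const] with c = i. *)
have dph i : derivs_Q (ph i) (w i) (fun u t => INR i.+1 - w i u t * v i u t).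
  apply: (derivs_Q_ext (phi_derivs_Q i dPsi)) => // u t u0 t0.
  have [_ ->] := speed i u t u0 t0.
  rewrite (rsum_ext (g := fun j => - (K i j * (v j u t * Du j u t)))); last first.
    by move=> j; rewrite pde // /v; ring.
  by rewrite rsum_opp; ring.
have dps i : derivs_Q (Psi i) (Du i) (fun u t => - (v i u t * Du i u t)).
  by apply: (derivs_Q_ext (dPsi i)) => // u t u0 t0; apply: pde.
have mono i u u' t : 0 <= u -> 0 <= t -> u < u' -> ph i u t < ph i u' t.
  by move=> u0 t0; apply: InD1_phi_mono; [apply: PsiD|].
have key i u1 t1 : 0 <= u1 -> 0 <= t1 -> Psi i u1 t1 = F i (ph i u1 t1 - INR i.+1 * t1).
  move=> u10 t10; set c := INR i.+1; set s := ph i u1 t1 - c * t1.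
  have c0 : 0 < c by apply: lt_0_INR; apply/ltP.
  (* The level phi_i = s + c t is attained exactly when s + c t >= 0, so t0 is the time at which the
     curve enters the quadrant. *)
  pose t0 := Rmax 0 (- s / c).
  have ph0 t : 0 <= t -> ph i 0 t = 0 by move=> t0'; apply: InD_phi0; case: (PsiD t t0').
  have phge : 0 <= ph i u1 t1.
    rewrite -(ph0 t1 t10); case: u10 => [lt|<-]; last by right.
    by apply/Rlt_le/mono => //; lra.
  have t01 : t0 <= t1.
    apply: Rmax_lub => //; apply/Rle_div_l => //; rewrite /s; lra.
  have st t : t0 <= t -> 0 <= s + c * t.
    move=> tt; have := Rle_trans _ _ _ (Rmax_r 0 (- s / c)) tt => /Rle_div_l => /(_ c0); lra.
  have t00 : 0 <= t0 by apply: Rmax_l.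
  (* The curve is chosen time by time, with no continuity; [level_const] reads its increments off
     phi. *)
  have exU t : exists u, t0 <= t -> 0 <= u /\ ph i u t = s + c * t.
    have [tt|nt] := Rle_dec t0 t; last by exists 0.
    have [u hu] := InD1_phi_surj i (PsiD t (Rle_trans _ _ _ t00 tt)) (st t tt).
    by exists u.
  have [U hU] := fchoice exU.
  have lc := level_const (dph i) (dps i) (fun u t u0 t0 => (speed i u t u0 t0).1) (mono i) t00 hU.
  have inj u u' t : 0 <= u -> 0 <= u' -> 0 <= t -> ph i u t = ph i u' t -> u = u'.
    move=> u0 u0' t0' e; have [lt|[//|gt]] := Rtotal_order u u'.
      by have := mono i u u' t u0 t0' lt; lra.
    by have := mono i u' u t u0' t0' gt; lra.
  have [Ut1 Ut1E] := hU t1 t01.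
  have U1 : U t1 = u1 by apply: (inj _ _ t1) => //; rewrite Ut1E /s; ring.
  rewrite -{1}U1 lc //; have [Ut0 Ut0E] := hU t0 (Rle_refl _).
  (* For s >= 0 the curve starts on t = 0, where the initial datum gives F_i(s). For s < 0 it starts
     at u = 0, where both Psi_i and F_i(s) are 0. *)
  have [s0|s0] := Rle_lt_dec 0 s.
    have t0E : t0 = 0.
      rewrite /t0 Rmax_left //; apply/Rle_div_l => //; lra.
    rewrite t0E in Ut0 Ut0E *; rewrite Psi0 // -(ext0_ge0 (psi0 i) Ut0) -FPhi; congr F.
    have -> : s = ph i (U 0) 0 by rewrite Ut0E; ring.
    rewrite /ph phiE /Phi; congr (_ - _).
    by apply: rsum_ext => j; rewrite ext0_ge0 // Psi0.
  have t0E : t0 = - s / c.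
    by rewrite /t0 Rmax_right //; apply: Rlt_le; apply: Rdiv_lt_0_compat; lra.
  have U0 : U t0 = 0.
    apply: (inj _ _ t0) => //; first lra.
    by rewrite Ut0E ph0 // t0E; field; lra.
  rewrite U0 F0; last lra.
  by case: (PsiD t0 t00) => -[PsiC _] _; case: (PsiC i).
have [Y HY] := is_Y_exists HF.
move=> i u t u0 t0; rewrite (psi_solE HF FPhi HY t0).2 // key //; congr F.
apply: (fixpoint_unique (G := F) (r := fun i => u - INR i.+1 * t) (e := fun i => ph i u t - INR i.+1 * t)
  (e' := fun i => Y i u t) L0 L1 (sys_lip HF)) => [k|k]; last exact: HY.
rewrite {1}/ph phiE.
rewrite (rsum_ext (g := fun j => K k j * F j (ph j u t - INR j.+1 * t))); first ring.
by move=> j; rewrite key.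
Qed.

End UniqueA.

(** * Second-order regularity and densities *)

Section LinDiff.
Context (I : nat) (L : 'I_I -> R).
Hypotheses (L0 : forall j, 0 <= L j) (L1 : ksum L < 1).
Context (r : 'I_I -> R) (a s au at' su st : 'I_I -> R -> R -> R).
Hypothesis aL : forall j u t, Rabs (a j u t) <= L j.
Hypothesis hs : forall u t, lin_sol r (fun j => a j u t) (fun j => s j u t).
Hypothesis sc : forall i u t, continuity_2d_pt (s i) u t.
Hypothesis ad : forall i u t, differentiable_pt_lim (a i) u t (au i u t) (at' i u t).
Hypothesis hsu : forall u t, lin_sol (fun i => 0 - rsum (fun j => K i j * (au j u t * s j u t)))
  (fun j => a j u t) (fun j => su j u t).
Hypothesis hst : forall u t, lin_sol (fun i => 0 - rsum (fun j => K i j * (at' j u t * s j u t)))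
  (fun j => a j u t) (fun j => st j u t).

(** In [implicit_diff] the remainder is (a_j - a_j(u, t)) s_j, a product of a factor vanishing at
    the point with the continuous s_j, so [diff_mult_cont] applies. *)
Lemma lin_diff i u t : differentiable_pt_lim (s i) u t (su i u t) (st i u t).
Proof.
apply: (implicit_diff (A := fun _ => 0) (B := fun _ => 0) (C := r) (al := fun j => a j u t)
  (be := fun j => au j u t * s j u t) (ga := fun j => at' j u t * s j u t)
  (du := fun i => su i u t) (dt := fun i => st i u t)
  (g := fun j u t => a j u t * s j u t) L0 L1 _ (fun j => aL j u t)) => [k u' t'|j||].
- by rewrite hs; ring.
- have h0 : differentiable_pt_lim (fun u' t' => a j u' t' + - a j u t) u t (au j u t + 0) (at' j u t + 0).
    exact: diff_plus (ad j u t) (diff_const _ u t).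
  have := diff_mult_cont h0 (Rplus_opp_r _) (sc j u t); rewrite !Rplus_0_r.
  by apply: diff_ext => u' t'; ring.
- exact: hsu.
- exact: hst.
Qed.

End LinDiff.

Lemma lin_rhs_cont (I : nat) (b s : 'I_I -> R -> R -> R) i u t :
  (forall j, continuity_2d_pt (b j) u t) -> (forall j, continuity_2d_pt (s j) u t) ->
  continuity_2d_pt (fun u t => 0 - rsum (fun j => K i j * (b j u t * s j u t))) u t.
Proof.
move=> bc sc; apply: continuity_2d_pt_minus; first exact: continuity_2d_pt_const.
apply: (rsum_continuity_2d (f := fun j u t => K i j * (b j u t * s j u t))) => j.
by apply: continuity_2d_pt_mult; [apply: continuity_2d_pt_const|apply: continuity_2d_pt_mult].
Qed.

Lemma C1_Q_2d f Du Dt : (forall u t, differentiable_pt_lim f u t (Du u t) (Dt u t)) ->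
  (forall u t, continuity_2d_pt Du u t) -> (forall u t, continuity_2d_pt Dt u t) -> C1_Q f Du Dt.
Proof.
move=> hf hu ht; split; first exact: (derivs_Q_diff (g := f)).
by split; apply: cont_Q_2d.
Qed.

Section SecondOrder.
Context (I : nat).
Implicit Types (i j : 'I_I).
Context (L : 'I_I -> R) (F f f2 : 'I_I -> R -> R) (Y : 'I_I -> R -> R -> R).
Hypothesis HF : slope_sys L F.
Hypothesis Ff : forall i x, derivable_pt_lim (F i) x (f i x).
Hypothesis ff2 : forall i x, derivable_pt_lim (f i) x (f2 i x).
Hypothesis f2cont : forall i, continuity (f2 i).
Hypothesis HY : is_Y F Y.
Context (w x : 'I_I -> R -> R -> R).
Hypothesis hw : forall u t, lin_sol (fun _ => 1) (fun j => f j (Y j u t)) (fun j => w j u t).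
Hypothesis hx : forall u t, lin_sol (fun i => INR i.+1) (fun j => f j (Y j u t)) (fun j => x j u t).

Let L0 : forall j, 0 <= L j. Proof. by case: HF. Qed.
Let L1 : ksum L < 1. Proof. by case: HF. Qed.
Let fcont i : continuity (f i).
Proof. by move=> z; apply: (derivable_continuous_pt _ _ (exist _ (f2 i z) (ff2 i z))). Qed.
Let fabs j u t : Rabs (f j (Y j u t)) <= L j.
Proof. by have := F_lim_bounds HF Ff j (Y j u t) => ?; rewrite Rabs_pos_eq; lra. Qed.
Let wc i u t : continuity_2d_pt (w i) u t := w_cont HF Ff fcont HY hw i u t.
Let xc i u t : continuity_2d_pt (x i) u t := x_cont HF Ff fcont HY hx i u t.

Let f2Y i u t := f2 i (Y i u t).
Let f2c i u t : continuity_2d_pt (f2Y i) u t.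
Proof. by apply: (continuity_1d_2d_pt_comp (f2 i) (Y i)); [apply: f2cont|apply: Y_cont HF HY i u t]. Qed.
Let fc i u t : continuity_2d_pt (fun u t => f i (Y i u t)) u t := fY_cont HF fcont HY i u t.

Let au i u t := f2Y i u t * w i u t.
Let at' i u t := - (f2Y i u t * x i u t).
Let auc i u t : continuity_2d_pt (au i) u t.
Proof. by apply: continuity_2d_pt_mult; [apply: f2c|apply: wc]. Qed.
Let atc i u t : continuity_2d_pt (at' i) u t.
Proof. by apply: continuity_2d_pt_opp; apply: continuity_2d_pt_mult; [apply: f2c|apply: xc]. Qed.

Let ad i u t : differentiable_pt_lim (fun u t => f i (Y i u t)) u t (au i u t) (at' i u t).
Proof.
by apply: diff_eq (diff_comp (ff2 i _) (Y_diff HF Ff HY hw hx i u t)) _ _; rewrite /au /at' /f2Y; ring.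
Qed.

(* The mixed derivatives of Y agree: both -d_u x and d_t w solve the same linear system,
   which gives the conservation law  d_t rho = - d_u (x f(Y)). *)
Lemma flow_C2 : exists Duu Dut Dtu Dtt : 'I_I -> R -> R -> R,
  [/\ forall i, C1_Q (fun u t => f i (Y i u t) * w i u t) (Duu i) (Dut i),
      forall i, C1_Q (fun u t => - (f i (Y i u t) * x i u t)) (Dtu i) (Dtt i),
      forall i u t, differentiable_pt_lim (fun u t => f i (Y i u t) * w i u t) u t (Duu i u t) (Dut i u t),
      forall i u t, continuity_2d_pt (Duu i) u t &
      forall i u t, Dut i u t = Dtu i u t].
Proof.
have ex b s := lin_exists_Q Y
  (fun i u t => 0 - rsum (fun j => K i j * (b j u t * s j u t))) L0 L1 (F_lim_bounds HF Ff).
have [wu hwu] := ex au w; have [wt hwt] := ex at' w.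
have [xu hxu] := ex au x; have [xt hxt] := ex at' x.
have dw := lin_diff L0 L1 fabs hw wc ad hwu hwt.
have dx := lin_diff L0 L1 fabs hx xc ad hxu hxt.
have sc b s sb : (forall j u t, continuity_2d_pt (b j) u t) -> (forall j u t, continuity_2d_pt (s j) u t) ->
    (forall u t, lin_sol (fun i => 0 - rsum (fun j => K i j * (b j u t * s j u t)))
      (fun j => f j (Y j u t)) (fun j => sb j u t)) ->
    forall i u t, continuity_2d_pt (sb i) u t.
  move=> bc sc h i u t.
  apply: (lin_cont (r := fun i u t => 0 - rsum (fun j => K i j * (b j u t * s j u t)))
    (a := fun j u t => f j (Y j u t)) L0 L1 fabs h) => k; last exact: fc.
  by apply: lin_rhs_cont => j.
have wuc := sc _ _ _ auc wc hwu; have wtc := sc _ _ _ atc wc hwt.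
have xuc := sc _ _ _ auc xc hxu; have xtc := sc _ _ _ atc xc hxt.
have mixed i u t : wt i u t = - xu i u t.
  apply: (lin_unique (x := fun i => wt i u t) (x' := fun i => - xu i u t) L0 L1 (fun j => fabs j u t) (hwt u t)) => k.
  rewrite [X in - X](hxu u t).
  rewrite (rsum_ext (f := fun j => K k j * (at' j u t * w j u t))
    (g := fun j => - (K k j * (au j u t * x j u t)))); last by move=> j; rewrite /at' /au; ring.
  rewrite (rsum_ext (f := fun j => K k j * (f j (Y j u t) * - xu j u t))
    (g := fun j => - (K k j * (f j (Y j u t) * xu j u t)))); last by move=> j; ring.
  by rewrite !rsum_opp; ring.
have comb1 i u t (g s g' s' : 'I_I -> R -> R -> R) : (forall i u t, continuity_2d_pt (g i) u t) ->
    (forall i u t, continuity_2d_pt (s i) u t) -> (forall i u t, continuity_2d_pt (g' i) u t) ->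
    (forall i u t, continuity_2d_pt (s' i) u t) ->
    continuity_2d_pt (fun u t => g i u t * s i u t + g' i u t * s' i u t) u t.
  by move=> *; apply: continuity_2d_pt_plus; apply: continuity_2d_pt_mult.
exists (fun i u t => w i u t * au i u t + f i (Y i u t) * wu i u t),
  (fun i u t => w i u t * at' i u t + f i (Y i u t) * wt i u t),
  (fun i u t => - (x i u t * au i u t + f i (Y i u t) * xu i u t)),
  (fun i u t => - (x i u t * at' i u t + f i (Y i u t) * xt i u t)).
have dfw i u t := diff_mult (ad i u t) (dw i u t).
have dfx i u t := diff_mult (ad i u t) (dx i u t).
split=> [i|i|i u t|i u t|i u t].
- apply: C1_Q_2d => [u t|u t|u t]; first exact: dfw.
    exact: (comb1 i u t w au (fun i u t => f i (Y i u t)) wu wc auc fc wuc).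
  exact: (comb1 i u t w at' (fun i u t => f i (Y i u t)) wt wc atc fc wtc).
- apply: C1_Q_2d => [u t|u t|u t].
  + by apply: diff_ext (diff_eq (diff_scal (-1) (dfx i u t)) _ _) => [u' t'||]; ring.
  + apply: continuity_2d_pt_opp.
    exact: (comb1 i u t x au (fun i u t => f i (Y i u t)) xu xc auc fc xuc).
  + apply: continuity_2d_pt_opp.
    exact: (comb1 i u t x at' (fun i u t => f i (Y i u t)) xt xc atc fc xtc).
- exact: dfw.
- exact: (comb1 i u t w au (fun i u t => f i (Y i u t)) wu wc auc fc wuc).
- by rewrite mixed /at' /au; ring.
Qed.

Lemma F_lim_neg i z : z < 0 -> f i z = 0.
Proof.
move=> z0; apply: (uniqueness_limite (F i) z) => // eps e0.
have d0 : 0 < - z by lra.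
exists (mkposreal _ d0) => h h0 /= hh; have := Rle_abs h => ?.
case: HF => _ _ _ Fz; rewrite !Fz; try lra.
by rewrite Rminus_diag /Rdiv Rmult_0_l Rminus_0_r Rabs_R0.
Qed.

End SecondOrder.

Lemma deriv_ge f f' c : (forall x, derivable_pt_lim f x (f' x)) -> (forall x, c <= f' x) ->
  forall x y, x <= y -> c * (y - x) <= f y - f x.
Proof.
move=> hf hc x y xy.
have [z [_ ->]] := MVT_gen f x y f' (fun z _ => proj2 (is_derive_Reals f z (f' z)) (hf z))
  (fun z _ => derivable_continuous_pt f z (exist _ (f' z) (hf z))).
by apply: Rmult_le_compat_r; [lra|apply: hc].
Qed.

(** For i = I the minimum of i and j is j. The condition sum_j 2 j rho_j < 1 thus says that the
    derivative of phi_I is positive. *)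
Lemma ksum_max (n : nat) (r : 'I_n.+1 -> R) : rsum (fun j => K ord_max j * r j) = ksum r.
Proof.
apply: rsum_ext => j; rewrite /K (_ : minn _ _ = j.+1) //; apply/minn_idPr.
exact: ltn_ord.
Qed.

(** * Primitives of admissible densities *)

Section Density.
Context (I : nat).
Implicit Types (i j : 'I_I).

Definition cumul (rho : 'I_I -> R -> R) i u := RInt (rho i) 0 u.

Context (rho : 'I_I -> R -> R).
Hypothesis rhoD : InDdens rho.

Lemma dens_cont i : continuity (ext0 (rho i)).
Proof.
move=> z; have [q [hq _]] := (proj1 rhoD i).2.
exact: (derivable_continuous_pt _ _ (exist _ (q z) (hq z))).
Qed.

Lemma dens_ge0 i u : 0 <= ext0 (rho i) u.
Proof.
have [u0|u0] := Rle_lt_dec 0 u; last by rewrite ext0_lt0; lra.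
by rewrite ext0_ge0 //; apply: (proj1 rhoD i).1.
Qed.

Lemma cumulE i u : ext0 (cumul rho i) u = RInt (ext0 (rho i)) 0 u.
Proof.
have [u0|u0] := Rle_lt_dec 0 u.
  rewrite ext0_ge0 //; apply: RInt_ext => z; rewrite Rmin_left // Rmax_right // => ?.
  by rewrite ext0_ge0 //; lra.
rewrite ext0_lt0 // (RInt_ext _ (fun _ => 0)) => [|z].
  by rewrite RInt_const /scal /= /mult /=; ring.
by rewrite Rmin_right ?Rmax_left; try lra; move=> ?; rewrite ext0_lt0 //; lra.
Qed.

Lemma cumul_lim i u : derivable_pt_lim (ext0 (cumul rho i)) u (ext0 (rho i) u).
Proof.
apply/is_derive_Reals.
have E z : RInt (ext0 (rho i)) 0 z = ext0 (cumul rho i) z by rewrite cumulE.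
apply: (is_derive_ext _ _ _ _ E).
apply: (is_derive_RInt _ _ 0); last exact/continuity_pt_filterlim/dens_cont.
apply: filter_forall => z; apply: RInt_correct; apply: ex_RInt_continuous => y _.
exact/continuity_pt_filterlim/dens_cont.
Qed.

(** The quotients a_j = rho_j / w_j lie in [0, L_j] and w solves the linear system with coefficients
    a and right-hand side 1, so the pointwise positivity of w improves to the uniform bound 1 -
    kappa. *)
Lemma dens_bounds : exists L, [/\ forall j, 0 <= L j, ksum L < 1 &
  forall i u, 1 - ksum L <= Phi' (fun j => ext0 (rho j)) i u <= 1 /\
    ext0 (rho i) u <= L i * Phi' (fun j => ext0 (rho j)) i u].
Proof.
case: (rhoD) => _ [rho1 [L [Lw rhoL]]].
have L1 : ksum L < 1 by rewrite wsum_ksum; lra.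
have w0 i u : 0 < Phi' (fun j => ext0 (rho j)) i u.
  rewrite /Phi'; have := Ksum_le i (fun j => dens_ge0 j u).
  have [u0|u0] := Rle_lt_dec 0 u.
    have := rho1 u u0; rewrite wsum2E (@ksum_ext _ _ (fun j => ext0 (rho j) u)); first lra.
    by move=> j; rewrite ext0_ge0.
  rewrite (_ : ksum _ = 0); first lra.
  by apply: rsum0 => j; rewrite ext0_lt0 //; ring.
have wE i u : 0 <= u -> dens_denom (fun j => rho j u) i = Phi' (fun j => ext0 (rho j)) i u.
  by move=> u0; rewrite dens_denomE; congr (_ - _); apply: rsum_ext => j; rewrite ext0_ge0.
have L0 j : 0 <= L j.
  apply: Rle_trans (rhoL j 0 (Rle_refl 0)); rewrite wE; last lra.
  apply: Rdiv_le_0_compat => //; have := dens_ge0 j 0; rewrite ext0_ge0 //; lra.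
exists L; split=> // i u.
pose a j := ext0 (rho j) u / Phi' (fun j => ext0 (rho j)) j u.
have aL j : 0 <= a j <= L j.
  split; first by apply: Rdiv_le_0_compat => //; apply: dens_ge0.
  have [u0|u0] := Rle_lt_dec 0 u; last by rewrite /a ext0_lt0 // /Rdiv Rmult_0_l.
  by rewrite /a -wE // ext0_ge0 //; apply: rhoL.
split; last by apply/Rle_div_l => //; case: (aL i).
apply: (lin_one_bounds (w := fun i => Phi' (fun j => ext0 (rho j)) i u) L1 aL) => k.
by congr (_ - _); apply: rsum_ext => j; rewrite /a; field; have := w0 j u; lra.
Qed.

Lemma dens_InD1 : InD1 (cumul rho).
Proof.
have [L [L0 L1 wL]] := dens_bounds.
have Phil := Phi_lim cumul_lim.
have prim0 i : cumul rho i 0 = 0 by rewrite /cumul RInt_point.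
have pmono i u v : u <= v -> 0 * (v - u) <= ext0 (cumul rho i) v - ext0 (cumul rho i) u.
  exact: (deriv_ge (cumul_lim i) (dens_ge0 i)).
have prim_ge0 i u : 0 <= u -> 0 <= cumul rho i u.
  by move=> u0; have := pmono i 0 u u0; rewrite !ext0_ge0 ?prim0 //; lra.
have phiE' i u : 0 <= u -> phi (cumul rho) i u = Phi (cumul rho) i u.
  by move=> u0; rewrite phiE; congr (_ - _); apply: rsum_ext => j; rewrite ext0_ge0.
have Phimono i u v : u <= v -> (1 - ksum L) * (v - u) <= Phi (cumul rho) i v - Phi (cumul rho) i u.
  by apply: (deriv_ge (Phil i)) => z; case: (wL i z) => -[].
have Phi0 i : Phi (cumul rho) i 0 = 0.
  rewrite /Phi rsum0 => [|j]; first ring.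
  by rewrite ext0_ge0 ?prim0; [ring|lra].
have contP (g : R -> R) : (forall u, 0 <= u -> continuity_pt (ext0 g) u) -> cont_pos g.
  move=> gc u u0 eps e0; have [d [d0 hd]] := gc u u0 eps e0; exists d; split=> // v v0 vu.
  have [->|uv] := Req_dec v u; first by rewrite Rminus_diag Rabs_R0.
  have := hd v; rewrite /dist /= /Rdist !ext0_ge0 //; apply; split=> //; split=> // e.
  by apply: uv.
have primC i : inC (cumul rho i).
  split; [exact: prim0|split; [exact: prim_ge0|split]].
    by apply: contP => u _; apply: (derivable_continuous_pt _ _ (exist _ _ (cumul_lim i u))).
  by move=> u v u0 uv; have := pmono i u v uv; rewrite !ext0_ge0; lra.
split; last first.
  move=> i; split; first exact: prim_ge0.
  by exists (ext0 (rho i)); split; [apply: cumul_lim|apply: dens_cont].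
split=> //; split.
  move=> i _; split; [split; [|split; [|split]]|split].
  - by rewrite phiE' ?Phi0 //; lra.
  - by move=> u u0; rewrite phiE' //; have := Phimono i 0 u u0; rewrite Phi0; nra.
  - move=> u u0 eps e0.
    have := derivable_continuous_pt _ _ (exist _ _ (Phil i u)) eps e0.
    move=> [d [d0 hd]]; exists d; split=> // v v0 vu; rewrite !phiE' //.
    have [->|uv] := Req_dec v u; first by rewrite Rminus_diag Rabs_R0.
    by apply: hd; split=> //; split=> // e; apply: uv.
  - by move=> u v u0 uv; rewrite !phiE'; try lra; have := Phimono i u v uv; nra.
  - by move=> u v u0 uv; rewrite !phiE'; try lra; have := Phimono i u v (Rlt_le _ _ uv); nra.
  move=> M; exists (Rmax 0 (M / (1 - ksum L))); split=> [|u uM]; first exact: Rmax_l.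
  have u0 := Rle_trans _ _ _ (Rmax_l _ _) uM.
  have /Rle_div_l {}uM := Rle_trans _ _ _ (Rmax_r _ _) uM.
  rewrite phiE' //; have := Phimono i 0 u u0; rewrite Phi0.
  have : M <= u * (1 - ksum L) by apply: uM; lra.
  lra.
exists L; split; first by have := wsum_ksum L; lra.
(* The pointwise bound rho_i <= L_i Phi_i' makes L_i Phi_i - psi_i non-decreasing, which bounds the
   difference quotients. *)
have quo i u v : 0 <= u -> u < v ->
    (cumul rho i v - cumul rho i u) / (phi (cumul rho) i v - phi (cumul rho) i u) <= L i.
  move=> u0 uv; rewrite !phiE'; try lra.
  have pm := Phimono i u v (Rlt_le _ _ uv).
  apply/Rle_div_l; first nra.
  have := @deriv_ge (fun z => L i * Phi (cumul rho) i z - ext0 (cumul rho i) z)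
    (fun z => L i * Phi' (fun j => ext0 (rho j)) i z - ext0 (rho i) z) 0 _ _ u v (Rlt_le _ _ uv).
  rewrite !ext0_ge0; try lra; move=> h; have := h _ _; move=> {}h; suff : 0 * (v - u) <= L i * Phi (cumul rho) i v - cumul rho i v - (L i * Phi (cumul rho) i u - cumul rho i u) by lra.
  apply: h => z; last by case: (wL i z) => _; lra.
  apply: (derivable_pt_lim_minus (fun z => L i * Phi (cumul rho) i z)); last exact: cumul_lim.
  exact: (derivable_pt_lim_scal (Phi (cumul rho) i)).
move=> i u1 u2 p1 p2 ne; have [lt|[//|gt]] := Rtotal_order u1 u2; last exact: quo.
rewrite (_ : _ / _ = (cumul rho i u2 - cumul rho i u1) / (phi (cumul rho) i u2 - phi (cumul rho) i u1)).
  exact: quo.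
rewrite !phiE' //; field; have := Phimono i u1 u2 (Rlt_le _ _ lt).
by split; nra.
Qed.

End Density.

(** * Integration of densities *)

(** Continuing f by its tangent line at 0 produces a two-sided derivative, so that the mean value
    theorem and the fundamental theorem of calculus apply up to the boundary. *)
Lemma pder_extend f l : (forall u, 0 <= u -> pder f u (l u)) ->
  forall x, derivable_pt_lim (fun u => if Rlt_dec u 0 then f 0 + l 0 * u else f u) x (l (Rmax x 0)).
Proof.
move=> hf x; set fe := fun u => _.
have feN u : u < 0 -> fe u = f 0 + l 0 * u by rewrite /fe; case: Rlt_dec.
have feP u : 0 <= u -> fe u = f u by rewrite /fe; case: Rlt_dec => // ? ?; lra.
move=> eps e0; have [x0|x0] := Rle_lt_dec 0 x; last first.
  have d0 : 0 < - x by lra.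
  exists (mkposreal _ d0) => h h0 /= hh; have := Rle_abs h => ?.
  rewrite !feN; try lra; rewrite Rmax_right; last lra.
  by rewrite (_ : _ - _ = 0) ?Rabs_R0 //; field.
have e2 : 0 < eps / 2 by lra.
have [d [d0 hd]] := hf x x0 _ e2.
(* For x > 0 the cap by x keeps x + h non-negative; at x = 0 a negative h lands on the tangent line,
   where the quotient is exact. *)
pose d' := if Rlt_dec 0 x then Rmin d x else d.
have [d'0 d'd] : 0 < d' /\ d' <= d.
  rewrite /d'; case: Rlt_dec => ?; last by split=> //; right.
  by split; [apply: Rmin_glb_lt|apply: Rmin_l].
exists (mkposreal _ d'0) => h h0 /= hh; rewrite Rmax_left // (feP x) //.
have [xh|xh] := Rle_lt_dec 0 (x + h).
  have A := hd h xh (Rlt_le_trans _ _ _ hh d'd); have hp := Rabs_pos_lt _ h0.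
  rewrite feP // (_ : _ / _ - _ = (f (x + h) - f x - l x * h) / h); last by field.
  by rewrite Rabs_div //; apply/Rlt_div_l => //; nra.
have xz : x = 0.
  apply: Rle_antisym x0; apply: Rnot_lt_le => xp; move: hh; rewrite /d'; case: Rlt_dec => //= ? hh.
  have := Rmin_r d x; have := Rle_abs (- h); rewrite Rabs_Ropp; lra.
rewrite xz feN; last lra.
by rewrite (_ : _ - _ = 0) ?Rabs_R0 //; field.
Qed.

(** Composition with the 1-Lipschitz retraction onto the quadrant makes a function continuous on the
    quadrant continuous on the plane, ready for integration and uniform continuity. *)
Definition clamp (g : R -> R -> R) (u t : R) : R := g (Rmax u 0) (Rmax t 0).

Lemma Rmax_lip a b : Rabs (Rmax a 0 - Rmax b 0) <= Rabs (a - b).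
Proof.
have [a0|a0] := Rle_lt_dec 0 a; have [b0|b0] := Rle_lt_dec 0 b.
- by rewrite !Rmax_left //; lra.
- by rewrite Rmax_left // Rmax_right ?Rabs_pos_eq; lra.
- by rewrite Rmax_right ?Rmax_left // ?Rabs_left1 ?[Rabs (a - b)]Rabs_left1; lra.
- by rewrite !Rmax_right ?Rminus_diag ?Rabs_R0; [apply: Rabs_pos|lra|lra].
Qed.

Lemma clamp_cont g : cont_Q g -> forall u t, continuity_2d_pt (clamp g) u t.
Proof.
move=> hg u t eps.
have [d [d0 hd]] := hg _ _ (Rmax_r u 0) (Rmax_r t 0) _ (cond_pos eps).
exists (mkposreal _ d0) => u' t' /= hu ht.
by apply: hd; try exact: Rmax_r; apply: Rle_lt_trans (Rmax_lip _ _) _.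
Qed.

Lemma clampE g u t : 0 <= u -> 0 <= t -> clamp g u t = g u t.
Proof. by move=> u0 t0; rewrite /clamp !Rmax_left. Qed.

Lemma clamp_continuous g t x : cont_Q g -> continuous (fun s => clamp g s t) x.
Proof. by move=> hg; apply/continuity_pt_filterlim; apply: cont_line; apply: clamp_cont. Qed.

Lemma continuous_Rscal k (f : R -> R) x : continuous f x -> continuous (fun s => k * f s) x.
Proof.
move=> /continuity_pt_filterlim fc; apply/continuity_pt_filterlim.
exact: (continuity_pt_scal f).
Qed.

Lemma clamp_ex_RInt g a b t : cont_Q g -> ex_RInt (fun s => clamp g s t) a b.
Proof. by move=> hg; apply: ex_RInt_continuous => z _; apply: clamp_continuous. Qed.

Lemma clamp_RInt g u t : 0 <= u -> 0 <= t ->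
  RInt (fun s => g s t) 0 u = RInt (fun s => clamp g s t) 0 u.
Proof.
move=> u0 t0; apply: RInt_ext => z; rewrite Rmin_left // => -[? _].
by rewrite clampE //; lra.
Qed.

Lemma abs_RInt_bound (f : R -> R) a b M : (forall x, continuous f x) ->
  (forall x, Rmin a b <= x <= Rmax a b -> Rabs (f x) <= M) ->
  Rabs (RInt f a b) <= M * Rabs (b - a).
Proof.
move=> fc fM.
have ex a' b' : ex_RInt f a' b' by apply: ex_RInt_continuous => z _; apply: fc.
have [ab|ba] := Rle_lt_dec a b.
  rewrite (Rabs_pos_eq (b - a)); last lra.
  rewrite Rmult_comm; apply: abs_RInt_le_const => // x ?; apply: fM.
  by rewrite Rmin_left // Rmax_right.
rewrite -opp_RInt_swap // /opp /= Rabs_Ropp (Rabs_minus_sym b) (Rabs_pos_eq (a - b)); last lra.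
rewrite Rmult_comm; apply: abs_RInt_le_const => //; first lra.
by move=> x ?; apply: fM; rewrite Rmin_right ?Rmax_left; lra.
Qed.

Lemma clamp_unif g u t eps : cont_Q g -> 0 < eps -> exists delta, 0 < delta /\
  forall s t', 0 <= s <= u -> Rabs (t' - t) < delta -> Rabs (clamp g s t' - clamp g s t) <= eps.
Proof.
move=> hg e0.
have [[d d0] hd] := uniform_continuity_2d (clamp g) 0 u (t - 1) (t + 1)
  (fun x y _ _ => clamp_cont hg x y) (mkposreal _ e0).
exists (Rmin d 1); split=> [|s t' su tt]; first by apply: Rmin_glb_lt; lra.
have t1 := Rlt_le_trans _ _ _ tt (Rmin_l _ _); have t2 := Rlt_le_trans _ _ _ tt (Rmin_r _ _).
apply: Rlt_le; apply: hd => //=; try lra; last by rewrite Rminus_diag Rabs_R0.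
by move: t2 => /Rabs_lt_between; lra.
Qed.

Lemma RInt_Rminus (f g : R -> R) a b : ex_RInt f a b -> ex_RInt g a b ->
  RInt (fun s => f s - g s) a b = RInt f a b - RInt g a b.
Proof. exact: (@RInt_minus R_CompleteNormedModule). Qed.

Lemma RInt_sub g u u' t t' : cont_Q g ->
  RInt (fun s => clamp g s t') 0 u' - RInt (fun s => clamp g s t) 0 u =
  RInt (fun s => clamp g s t') u u' + RInt (fun s => clamp g s t' - clamp g s t) 0 u.
Proof.
move=> hg; have ex a b t'' := @clamp_ex_RInt g a b t'' hg.
rewrite (RInt_Rminus (ex _ _ _) (ex _ _ _)).
have <- := @RInt_Chasles R_CompleteNormedModule _ _ _ _ (ex 0 u t') (ex u u' t').
rewrite -[plus _ _]/(Rplus _ _); ring.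
Qed.

Lemma RInt_cont_Q g : cont_Q g -> cont_Q (fun u t => RInt (fun s => g s t) 0 u).
Proof.
move=> hg u t u0 t0 eps e0.
set M := Rabs (clamp g u t) + 1; have M0 : 0 < M by rewrite /M; have := Rabs_pos (clamp g u t); lra.
have [[d1 d10] hd1] := clamp_cont hg u t (mkposreal _ Rlt_0_1).
have e2 : 0 < eps / (2 * (u + 1)) by apply: Rdiv_lt_0_compat; lra.
have [d2 [d20 hd2]] := clamp_unif u t hg e2.
have d30 : 0 < eps / (2 * M) by apply: Rdiv_lt_0_compat; lra.
exists (Rmin d1 (Rmin d2 (eps / (2 * M)))).
split=> [|u' t' u'0 t'0]; first by do 2 (apply: Rmin_glb_lt => //).
move=> /Rmin_Rgt_l [hu1 /Rmin_Rgt_l [_ hu3]] /Rmin_Rgt_l [ht1 /Rmin_Rgt_l [ht2 _]].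
rewrite (clamp_RInt g u'0 t'0) (clamp_RInt g u0 t0) RInt_sub //; apply: Rle_lt_trans (Rabs_triang _ _) _.
have A : Rabs (RInt (fun s => clamp g s t') u u') <= M * Rabs (u' - u).
  apply: abs_RInt_bound => x; first exact: clamp_continuous.
  move=> hx; have xu : Rabs (x - u) <= Rabs (u' - u).
    by move: hx; rewrite /Rmin /Rmax; case: Rle_dec => ? ?; rewrite /Rabs; case: Rcase_abs => ?; case: Rcase_abs => ?; lra.
  have /= := hd1 x t' (Rle_lt_trans _ _ _ xu hu1) ht1.
  have := Rabs_triang (clamp g x t' - clamp g u t) (clamp g u t).
  by rewrite (_ : _ - _ + _ = clamp g x t') /M; [lra|ring].
have B : Rabs (RInt (fun s => clamp g s t' - clamp g s t) 0 u) <= eps / (2 * (u + 1)) * Rabs (u - 0).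
  apply: abs_RInt_bound => x.
    by apply: (continuous_minus (V := R_NormedModule) (fun s => clamp g s t')); apply: clamp_continuous.
  by rewrite Rmin_left // Rmax_right // => hx; apply: hd2.
rewrite Rminus_0_r (Rabs_pos_eq u) // in B.
have A' : M * Rabs (u' - u) < eps / 2.
  have := Rmult_lt_compat_l _ _ _ M0 hu3; rewrite (_ : M * (eps / (2 * M)) = eps / 2); first lra.
  by field; lra.
have B' : eps / (2 * (u + 1)) * u <= eps / 2.
  rewrite (_ : eps / 2 = eps / (2 * (u + 1)) * (u + 1)); last by field; lra.
  by apply: Rmult_le_compat_l; lra.
lra.
Qed.

Lemma derivs_Q_cont f Du Dt : derivs_Q f Du Dt -> cont_Q f.
Proof.
move=> hf u t u0 t0 eps e0.
have [d [d0 hd]] := hf u t u0 t0 1 Rlt_0_1.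
set M := Rabs (Du u t) + Rabs (Dt u t) + 2.
have M0 : 0 < M by rewrite /M; have := Rabs_pos (Du u t); have := Rabs_pos (Dt u t); lra.
have e2 : 0 < eps / (2 * M) by apply: Rdiv_lt_0_compat; lra.
exists (Rmin d (eps / (2 * M))); split=> [|u' t' u'0 t'0]; first exact: Rmin_glb_lt.
move=> /Rmin_Rgt_l [hu1 hu2] /Rmin_Rgt_l [ht1 ht2].
have := hd (u' - u) (t' - t); rewrite !Rplus_minus => /(_ u'0 t'0 hu1 ht1).
set D := f u' t' - f u t; set a := Du u t; set b := Dt u t => A.
have T1 := Rabs_triang (D - a * (u' - u) - b * (t' - t)) (a * (u' - u) + b * (t' - t)).
rewrite (_ : _ + (_ + _) = D) in T1; last ring.
have T2 := Rabs_triang (a * (u' - u)) (b * (t' - t)); rewrite !Rabs_mult in T2.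
have {}hu2 := Rmult_lt_compat_l _ _ _ M0 hu2; have {}ht2 := Rmult_lt_compat_l _ _ _ M0 ht2.
rewrite (_ : M * (eps / (2 * M)) = eps / 2) in hu2 ht2; last by field; lra.
have := Rabs_pos (u' - u); have := Rabs_pos (t' - t); have := Rabs_pos a; have := Rabs_pos b.
by move: hu2 ht2; rewrite /M -/a -/b => *; nra.
Qed.

(** The increment is split by [RInt_sub]: the strip between u and u + h contributes f(u, t) h, and
    the change of time on [0, u] contributes k times the integral of Dt, by the mean value theorem
    in t and the uniform continuity of Dt. *)
Lemma RInt_C1 f Du Dt : C1_Q f Du Dt ->
  C1_Q (fun u t => RInt (fun s => f s t) 0 u) f (fun u t => RInt (fun s => Dt s t) 0 u).
Proof.
move=> [hf [_ Dtc]]; have fc := derivs_Q_cont hf.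
split; last by split=> //; apply: RInt_cont_Q.
move=> u t u0 t0 eps e0.
have [[d1 d10] hd1] := clamp_cont fc u t (mkposreal _ e0).
(* The tolerance is integrated over a length u; u + 1 avoids dividing by zero at u = 0. *)
have e2 : 0 < eps / (u + 1) by apply: Rdiv_lt_0_compat; lra.
have [d2 [d20 hd2]] := clamp_unif u t Dtc e2.
exists (Rmin d1 d2); split=> [|h k uh tk]; first exact: Rmin_glb_lt.
move=> /Rmin_Rgt_l [h1 _] /Rmin_Rgt_l [k1 k2].
rewrite (clamp_RInt f uh tk) (clamp_RInt f u0 t0) (clamp_RInt Dt u0 t0) RInt_sub //.
have A : Rabs (RInt (fun s => clamp f s (t + k) - f u t) u (u + h)) <= eps * Rabs (u + h - u).
  apply: abs_RInt_bound => x.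
    by apply: (continuous_minus (V := R_NormedModule) (fun s => clamp f s (t + k))); [apply: clamp_continuous|apply: continuous_const].
  move=> hx; have xu : Rabs (x - u) <= Rabs h.
    by move: hx; rewrite /Rmin /Rmax; case: Rle_dec => ? ?; rewrite /Rabs; case: Rcase_abs => ?; case: Rcase_abs => ?; lra.
  rewrite -(@clampE f u t) //; apply: Rlt_le; apply: hd1 => /=; first lra.
  by rewrite (_ : t + k - t = k) //; ring.
have B : Rabs (RInt (fun s => (clamp f s (t + k) - clamp f s t) - k * clamp Dt s t) 0 u)
    <= (eps / (u + 1) * Rabs k) * Rabs (u - 0).
  apply: abs_RInt_bound => x.
    apply: (continuous_minus (V := R_NormedModule) (fun s => clamp f s (t + k) - clamp f s t)).
      by apply: (continuous_minus (V := R_NormedModule) (fun s => clamp f s (t + k))); apply: clamp_continuous.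
    refine (@continuous_Rscal k (fun s => clamp Dt s t) x _); exact: clamp_continuous.
  rewrite Rmin_left // Rmax_right // => hx; have x0 : 0 <= x by lra.
  have pd s : 0 <= s -> pder (f x) s (Dt x s).
    move=> s0 eps' e'0; have [d [d0 hd]] := hf x s x0 s0 _ e'0; exists d; split=> // h' sh' hh'.
    have := hd 0 h'; rewrite !Rplus_0_r Rabs_R0 Rmult_0_r Rminus_0_r Rplus_0_l; exact.
  have lim := pder_extend pd.
  have [c [hc]] := MVT_gen _ t (t + k) _ (fun z _ => proj2 (is_derive_Reals _ z _) (lim z))
    (fun z _ => derivable_continuous_pt _ z (exist _ _ (lim z))).
  case: Rlt_dec => /= ?; first lra.
  case: Rlt_dec => /= ?; first lra.
  rewrite !clampE //; try lra; move=> ->.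
  rewrite (_ : _ - _ = (Dt x (Rmax c 0) - Dt x t) * k); last ring.
  rewrite Rabs_mult; apply: Rmult_le_compat_r; first exact: Rabs_pos.
  have := hd2 x c hx; rewrite {1}/clamp (Rmax_left x) // clampE //; apply.
  apply: Rle_lt_trans k2; move: hc; rewrite /Rmin /Rmax; case: Rle_dec => ? ?; rewrite /Rabs; case: Rcase_abs => ?; case: Rcase_abs => ?; lra.
have E1 : RInt (fun s => clamp f s (t + k) - f u t) u (u + h) = RInt (fun s => clamp f s (t + k)) u (u + h) - f u t * h.
  rewrite (RInt_Rminus (g := fun _ => f u t)); [|exact: clamp_ex_RInt|exact: ex_RInt_const].
  by rewrite RInt_const /scal /= /mult /=; ring.
have E2 : RInt (fun s => (clamp f s (t + k) - clamp f s t) - k * clamp Dt s t) 0 u =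
    RInt (fun s => clamp f s (t + k) - clamp f s t) 0 u - RInt (fun s => clamp Dt s t) 0 u * k.
  rewrite (RInt_Rminus (f := fun s => clamp f s (t + k) - clamp f s t) (g := fun s => k * clamp Dt s t)).
  - rewrite (@RInt_scal R_CompleteNormedModule (fun s => clamp Dt s t) 0 u k); last exact: clamp_ex_RInt.
    by rewrite /scal /= /mult /=; ring.
  - apply: (@ex_RInt_minus R_NormedModule (fun s => clamp f s (t + k))); exact: clamp_ex_RInt.
  - apply: (@ex_RInt_scal R_NormedModule (fun s => clamp Dt s t)); exact: clamp_ex_RInt.
rewrite (_ : _ - _ - _ = RInt (fun s => clamp f s (t + k) - f u t) u (u + h) +
  RInt (fun s => (clamp f s (t + k) - clamp f s t) - k * clamp Dt s t) 0 u); last by rewrite E1 E2; ring.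
apply: Rle_trans (Rabs_triang _ _) _.
rewrite (_ : u + h - u = h) in A; last ring.
rewrite Rminus_0_r (Rabs_pos_eq u) // in B.
have B' : eps / (u + 1) * Rabs k * u <= eps * Rabs k.
  rewrite (_ : eps * Rabs k = eps / (u + 1) * Rabs k * (u + 1)); last by field; lra.
  by apply: Rmult_le_compat_l; [apply: Rmult_le_pos; [lra|apply: Rabs_pos]|lra].
lra.
Qed.

Lemma pder_ext f g u l : 0 <= u -> (forall u, 0 <= u -> f u = g u) -> pder f u l -> pder g u l.
Proof.
move=> u0 fg hf eps e0; have [d [d0 hd]] := hf eps e0; exists d; split=> // h uh hh.
by rewrite -!fg //; apply: hd.
Qed.

Lemma C1_Q_ext f g Du Dt Du' Dt' : C1_Q f Du Dt ->
  (forall u t, 0 <= u -> 0 <= t -> f u t = g u t) ->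
  (forall u t, 0 <= u -> 0 <= t -> Du u t = Du' u t) ->
  (forall u t, 0 <= u -> 0 <= t -> Dt u t = Dt' u t) -> C1_Q g Du' Dt'.
Proof.
have cQ h h' : cont_Q h -> (forall u t, 0 <= u -> 0 <= t -> h u t = h' u t) -> cont_Q h'.
  move=> hc hh u t u0 t0 eps e0; have [d [d0 hd]] := hc u t u0 t0 eps e0.
  by exists d; split=> // u' t' u'0 t'0; rewrite -!hh //; apply: hd.
move=> [hf [hu ht]] fg fu ft; split; last by split; [apply: cQ hu fu|apply: cQ ht ft].
move=> u t u0 t0 eps e0; have [d [d0 hd]] := hf u t u0 t0 eps e0.
by exists d; split=> // h k uh tk; rewrite -!fg // -fu // -ft //; apply: hd.
Qed.

Lemma FTC_pos f l u : 0 <= u -> (forall u, 0 <= u -> pder f u (l u)) ->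
  (forall x, continuous (fun s => l (Rmax s 0)) x) -> RInt l 0 u = f u - f 0.
Proof.
move=> u0 hf lc.
have := is_RInt_derive _ _ 0 u (fun x _ => proj2 (is_derive_Reals _ x _) (pder_extend hf x)) (fun x _ => lc x).
move=> /is_RInt_unique; rewrite /minus /plus /opp /=.
case: Rlt_dec => ?; first lra; case: Rlt_dec => ?; first lra.
move=> E; rewrite [RHS]/Rminus -E; apply: RInt_ext => x; rewrite Rmin_left // => -[? _].
by rewrite Rmax_left //; lra.
Qed.

Lemma cont_ext0_0 f : continuity_pt (ext0 f) 0 -> f 0 = 0.
Proof.
move=> fc; apply: NNPP => ne; have [d [d0 hd]] := fc _ (Rabs_pos_lt _ ne).
have := hd (- (d / 2)); rewrite /dist /= /Rdist ext0_lt0; last lra.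
rewrite ext0_ge0; last lra.
rewrite !Rminus_0_l Rminus_0_r !Rabs_Ropp Rabs_pos_eq; last lra.
move=> hh; apply: (Rlt_irrefl (Rabs (f 0))); apply: hh.
by split; [split=> //; lra|lra].
Qed.

(** * Reduction of the conservation law to the transport equation *)

Section PartB.
Context (I : nat).
Implicit Types (i j : 'I_I).

(** Integrating the conservation law over [0, u] gives minus the flux at u plus the flux at 0. The
    latter vanishes because the zero extension of rho_i(., t) is continuous, which forces rho_i(0,
    t) = 0. *)
Lemma solves_b_cumul (rho0 : 'I_I -> R -> R) rho : InDdens rho0 -> solves_b rho0 rho ->
  solves_a (cumul rho0) (fun i u t => cumul (fun i u => rho i u t) i u).
Proof.
move=> rho0D [rhoge [rhoD [rhoinit [Ru [Rt [G [C1 pde]]]]]]].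
have rhot0 i t : 0 <= t -> rho i 0 t = 0.
  by move=> t0; apply: (@cont_ext0_0 (fun u => rho i u t)); apply: (dens_cont (rhoD t t0) i).
split; [|split; [|split]].
- move=> i u t u0 t0; rewrite /cumul; apply: RInt_ge_0 => //.
    apply: (ex_RInt_ext (fun s => clamp (rho i) s t)).
      by move=> x; rewrite Rmin_left // => -[? _]; rewrite clampE //; lra.
    by apply: clamp_ex_RInt; case: (C1 i) => /derivs_Q_cont.
  by move=> x ?; apply: rhoge => //; lra.
- by move=> t t0; apply: dens_InD1; apply: rhoD.
- move=> i u u0; apply: RInt_ext => x; rewrite Rmin_left // => -[? _].
  by apply: rhoinit; lra.
exists rho, (fun i u t => - (veff (fun j => rho j u t) i * rho i u t)); split=> // i.
apply: (C1_Q_ext (RInt_C1 (C1 i))) => // u t u0 t0.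
have RtG s : 0 <= s -> Rt i s t = -1 * G i s t by move=> s0; have [_ ->] := pde i s t s0 t0; ring.
rewrite (RInt_ext _ (fun s => -1 * G i s t)); last first.
  by move=> x; rewrite Rmin_left // => -[? _]; apply: RtG; lra.
have [_ [_ Rtc]] := C1 i.
(* Only the existence of the flux derivative G is given; its continuity comes from the equation G =
   - Rt. *)
have Gc x : continuous (fun s => G i (Rmax s 0) t) x.
  apply: (continuous_ext (fun s => -1 * clamp (Rt i) s t)) => [s|].
    rewrite /clamp (Rmax_left t) // (RtG _ (Rmax_r s 0)).
    by rewrite -Rmult_assoc (_ : -1 * -1 = 1) ?Rmult_1_l //; ring.
  refine (@continuous_Rscal (-1) (fun s => clamp (Rt i) s t) x _); exact: clamp_continuous.
have exG : ex_RInt (fun s => G i s t) 0 u.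
  apply: (ex_RInt_ext (fun s => G i (Rmax s 0) t)); last by apply: ex_RInt_continuous => z _.
  by move=> x; rewrite Rmin_left // => -[? _]; rewrite Rmax_left //; lra.
rewrite (@RInt_scal R_CompleteNormedModule (fun s => G i s t) 0 u (-1)) //.
rewrite (FTC_pos (f := fun u => veff (fun j => rho j u t) i * rho i u t) u0 _ Gc).
  by rewrite rhot0 // /scal /= /mult /=; ring.
by move=> u' u'0; have [] := pde i u' t u'0 t0.
Qed.

End PartB.

Lemma flow_InDdens (I : nat) (L : 'I_I -> R) (F f : 'I_I -> R -> R) (Y w : 'I_I -> R -> R -> R)
  (Duu : 'I_I -> R -> R) t : (0 < I)%nat -> slope_sys L F ->
  (forall i x, derivable_pt_lim (F i) x (f i x)) -> is_Y F Y ->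
  (forall u t, lin_sol (fun _ => 1) (fun j => f j (Y j u t)) (fun j => w j u t)) ->
  (forall i u, derivable_pt_lim (fun u => f i (Y i u t) * w i u t) u (Duu i u)) ->
  (forall i, continuity (Duu i)) -> 0 <= t ->
  InDdens (fun i u => f i (Y i u t) * w i u t).
Proof.
move=> I0 HF Ff HY hw hD Dc t0; case: (HF) => L0 L1 _ _.
have fL i u : 0 <= f i (Y i u t) <= L i by apply: (F_lim_bounds HF Ff).
have wb i u : 1 - ksum L <= w i u t <= 1 by apply: (lin_one_bounds L1 (fun j => fL j u) (hw u t)).
split; [move=> i; split|split].
- by move=> u u0; apply: Rmult_le_pos; [case: (fL i u)|have := wb i u; lra].
- exists (Duu i); split=> // x.
  have E u : f i (Y i u t) * w i u t = ext0 (fun u => f i (Y i u t) * w i u t) u.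
    have [u0|u0] := Rle_lt_dec 0 u; first by rewrite ext0_ge0.
    by rewrite ext0_lt0 // (F_lim_neg HF Ff) ?Rmult_0_l //; apply: (Y_lt0 HF HY).
  by apply/is_derive_Reals; apply: (is_derive_ext _ _ _ _ E); apply/is_derive_Reals.
- move=> u u0; rewrite wsum2E.
  (* The sum of the 2 j rho_j is 1 - w_I by [ksum_max], and w_I >= 1 - kappa > 0. *)
  case: I I0 L F f Y w Duu HF Ff HY hw hD Dc L0 L1 fL wb => // n _ L F f Y w Duu _ _ _ hw _ _ _ L1 _ wb.
  have := wb ord_max u; rewrite (hw u t ord_max).
  rewrite -(ksum_max (fun j => f j (Y j u t) * w j u t)); lra.
exists L; split=> [|i u u0]; first by have := wsum_ksum L; lra.
rewrite (dens_denom_lin (hw u t)) // /Rdiv Rmult_assoc Rinv_r; first by case: (fL i u); lra.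
by have := wb i u; lra.
Qed.

Theorem theorem1p5 (I : nat) (HI : (0 < I)%nat) :
  (* (a) *)
  (forall psi0 : 'I_I -> R -> R,
     InD1 psi0 ->
     solves_a psi0 (psi_sol psi0) /\
     (forall Psi, solves_a psi0 Psi ->
        forall i u t, 0 <= u -> 0 <= t -> Psi i u t = psi_sol psi0 i u t)) /\
  (* (b) *)
  (forall rho0 : 'I_I -> R -> R,
     InDdens rho0 ->
     let psi0 := fun i u => RInt (rho0 i) 0 u in
     exists Du Dt : 'I_I -> R -> R -> R,
       (forall i, nonneg_Q (psi_sol psi0 i) /\ C2_Q (psi_sol psi0 i) (Du i) (Dt i)) /\
       solves_b rho0 Du /\
       (forall rho, solves_b rho0 rho ->
          forall i u t, 0 <= u -> 0 <= t -> rho i u t = Du i u t)).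
Proof.
split=> [psi0 psi0D|rho0 rho0D psi0].
  have [L [F [f [HF FPhi Ff fc]]]] := InD1_sys psi0D.
  have [Y HY] := is_Y_exists HF; case: (HF) => L0 L1 _ _.
  have [w hw] := lin_exists_Q Y (fun _ _ _ => 1) L0 L1 (F_lim_bounds HF Ff).
  have [x hx] := lin_exists_Q Y (fun i _ _ => INR i.+1) L0 L1 (F_lim_bounds HF Ff).
  split; first exact: (flow_solves HF Ff fc HY hw hx FPhi).
  by move=> Psi hPsi; apply: solves_a_unique.
have psi0D : InD1 psi0 := dens_InD1 rho0D.
have [L [F [HF FPhi]]] := InD_sys psi0D.1.
have [f [Ff fc f2ex]] := sys_C1 HF FPhi (cumul_lim rho0D) (dens_cont rho0D).
have [q hq] := fchoice (fun i => (proj1 rho0D i).2).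
have [f2 [ff2 f2c]] := f2ex q (fun i => (hq i).1) (fun i => (hq i).2).
have [Y HY] := is_Y_exists HF; case: (HF) => L0 L1 _ _.
have [w hw] := lin_exists_Q Y (fun _ _ _ => 1) L0 L1 (F_lim_bounds HF Ff).
have [x hx] := lin_exists_Q Y (fun i _ _ => INR i.+1) L0 L1 (F_lim_bounds HF Ff).
have [Duu [Dut [Dtu [Dtt [C1u C1t du duc mixed]]]]] := flow_C2 HF Ff ff2 f2c HY hw hx.
have C1 := flow_C1 HF Ff fc HY hw hx FPhi.
pose Du i u t := f i (Y i u t) * w i u t.
exists Du, (fun i u t => - (f i (Y i u t) * x i u t)); split; [|split].
- move=> i; split; first exact: (flow_ge0 HF HY FPhi).
  split; first exact: C1.
  by split; [exists (Duu i), (Dut i); apply: C1u|exists (Dtu i), (Dtt i); apply: C1t].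
- split; [|split; [|split]].
  + move=> i u t u0 t0; apply: Rmult_le_pos; first by case: (F_lim_bounds HF Ff i (Y i u t)).
    by have := w_bounds HF Ff hw i u t; lra.
  + move=> t t0; apply: (flow_InDdens (Duu := fun i u => Duu i u t) HI HF Ff HY hw) => //.
      by move=> i u; apply: diff_line (du i u t).
    by move=> i u; apply: (@cont_line (Duu i)).
  (* At t = 0 both [Du i] and [rho0 i] are derivatives of the same primitive, up to the boundary. *)
  + move=> i u u0; apply: (pder_unique u0 (derivs_Q_pder (C1 i).1 u0 (Rle_refl 0))).
    apply: (pder_ext (f := psi0 i) u0) => [z z0|]; first by rewrite (flow_init HF HY FPhi).
    by rewrite -(ext0_ge0 (rho0 i) u0); apply: lim_pder u0 (cumul_lim rho0D i u).
  exists Duu, Dut, (fun i u t => - Dtu i u t); split=> [|i u t u0 t0]; first exact: C1u.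
  split; last by rewrite mixed; ring.
  (* The flux is minus the time derivative of psi_i, so its u-derivative is provided by [C1t], and
     [mixed] turns it into minus d_t rho_i. *)
  have fx v : f i (Y i v t) * x i v t = veff (fun j => Du j v t) i * Du i v t.
    by rewrite (flow_speed HF Ff hw hx) /Du; ring.
  move=> eps e0; have [d [d0 hd]] := derivs_Q_pder (C1t i).1 u0 t0 e0.
  exists d; split=> // h uh hh; have := hd h uh hh; rewrite -!fx.
  rewrite (_ : _ - _ - _ = - (f i (Y i (u + h) t) * x i (u + h) t - f i (Y i u t) * x i u t - - Dtu i u t * h)); last ring.
  by rewrite Rabs_Ropp.
move=> rho hrho i u t u0 t0.
(* The primitives of the two densities coincide by uniqueness in (a); differentiating in u recovers
   the densities. *)
have E := solves_a_unique psi0D (solves_b_cumul rho0D hrho).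
case: hrho => _ [_ [_ [Ru [Rt [G [C1rho _]]]]]].
apply: (pder_unique u0 _ (derivs_Q_pder (C1 i).1 u0 t0)).
apply: (pder_ext u0 (fun z z0 => E i z t z0 t0)).
exact: (derivs_Q_pder (RInt_C1 (C1rho i)).1 u0 t0).
Qed.
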